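(* Let $p\ge1$, $q>1$, $\boldsymbol a\in(-1,\infty)^q$, $\boldsymbol\beta\in\mathbb R^p$ with $\beta_i+a_\rho>-1$ for all $i,\rho$. Let $\boldsymbol\eta\in\mathbb N_0^q$ be on the step-line, let $\boldsymbol m\in\mathbb N_0^p$ with $|\boldsymbol m|=|\boldsymbol\eta|-1$, and let $D^{(1)}_{\boldsymbol\eta,\boldsymbol m},\dots,D^{(q)}_{\boldsymbol\eta,\boldsymbol m}$ be the pure Euler components defined in the context. For $0\le k\le\eta_\ell-1$ set $\boldsymbol K^{k,\ell}=(K_1^{k,\ell},\dots,K_q^{k,\ell})$ with $K_\sigma^{k,\ell}=k+1$ if $\sigma\le\ell$ and $K_\sigma^{k,\ell}=k$ if $\sigma>\ell$, and $n_\rho^{k,\ell}=K_\rho^{k,\ell}-1$. Put $\boldsymbol B_\rho=(B_{1,\rho},\dots,B_{p,\rho})$ with $B_{i,\rho}=\beta_i+a_\rho+1$, and $\boldsymbol C_\rho=(C_{1,\rho},\dots,C_{q,\rho})$ with $C_{\sigma,\rho}=a_\sigma-a_\rho$. Suppose first that $a_\rho-a_\sigma\notin\mathbb Z$ for $\rho\ne\sigma$, and define $$c_{k,\ell}=\sum_{\substack{1\le\rho\le q\\ K_\rho^{k,\ell}\ge1}}\frac{(\boldsymbol B_\rho)_{\boldsymbol m}}{n_\rho^{k,\ell}!\,(\boldsymbol C_\rho^{*\rho})_{(\boldsymbol K^{k,\ell})^{*\rho}}}\;{}_{p+q}F_{p+q-1}\!\left(\begin{matrix}-n_\rho^{k,\ell},\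 \boldsymbol B_\rho+\boldsymbol m,\ \mathbf 1_{q-1}-\boldsymbol C_\rho^{*\rho}-(\boldsymbol K^{k,\ell})^{*\rho}\\ \boldsymbol B_\rho,\ \mathbf 1_{q-1}-\boldsymbol C_\rho^{*\rho}\end{matrix};1\right),$$ where the series terminates at $n_\rho^{k,\ell}$. Set $c_{k,\ell}=0$ when $k\ge\eta_\ell$, and $$d_{h,k}=\sum_{\ell=h}^qe_{\ell-h}(a_1,\dots,a_{\ell-1})\,c_{k,\ell},\qquad 1\le h\le q,$$ where $e_j$ denotes the elementary symmetric polynomial and $e_0=1$. Then $$D^{(h)}_{\boldsymbol\eta,\boldsymbol m}(x)=\sum_{k=0}^{\eta_h-1}d_{h,k}x^k,\qquad 1\le h\le q.$$ If two of the lattice nodes $-a_\rho-j$ coalesce, the same formula is understood by continuity, equivalently by replacing ordinary divided differences by confluent ones. [Here $c_{k,\ell}$ is the divided difference of the polynomial $P(z)=(\boldsymbol\beta+(1-z)\mathbf 1_p)_{\boldsymbol m}$ at the nodes $-a_1,\dots,-a_q,-a_1-1,\dots,-a_q-1,\dots$ up to and including $-a_\ell-k$.]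
   Context: Conventions. $(c)_k=c(c+1)\cdots(c+k-1)$. For $\boldsymbol c=(c_1,\dots,c_d)$, $\boldsymbol\nu\in\mathbb N_0^d$: $\Gamma(\boldsymbol c)=\prod\Gamma(c_i)$, $(\boldsymbol c)_k=\prod(c_i)_k$, $(\boldsymbol c)_{\boldsymbol\nu}=\prod(c_i)_{\nu_i}$, $|\boldsymbol\nu|=\sum\nu_i$; $\mathbf 1_d=(1,\dots,1)$; $\boldsymbol c^{*i}$ is $\boldsymbol c$ with the $i$-th entry deleted; $\mathbb P_N$ is the space of complex polynomials of degree at most $N$ ($\{0\}$ if $N<0$). ${}_uF_v(A;B;x)=\sum_k\frac{(A)_k}{(B)_k}\frac{x^k}{k!}$. $\boldsymbol\eta\in\mathbb N_0^q$ is on the step-line if its components are nonincreasing and differ by at most one. Pure Euler setting (the Laguerre I setting with no beta block, $r=0$, $s=q$). $\mathcal G_a(x)=x^ae^{-x}$ on $(0,\infty)$, $(f*g)(x)=\int_0^\infty f(t)g(x/t)dt/t$, $w_0=\mathcal G_{a_1}*\cdots*\mathcal G_{a_q}$, so $\int_0^\infty x^{z-1}w_0(x)dx=\Gamma(z\mathbf 1_q+\boldsymbol a)$. With $\mathscr D=-x\frac{d}{dx}$ put $v_h=\mathscr D^{h-1}w_0$, $1\le h\le q$. The pure Euler components are the polynomials $D^{(h)}_{\boldsymbol\eta,\boldsymbol m}\in\mathbb P_{\eta_h-1}$ (uniquely) determined by the requirement that $\mathcal B_{\boldsymbol\eta,\boldsymbol m}=\sum_{h=1}^qD^{(h)}_{\boldsymbol\eta,\boldsymbol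 m}v_h$ satisfies $$\int_0^\infty x^{z-1}\mathcal B_{\boldsymbol\eta,\boldsymbol m}(x)\,dx=\Gamma(z\mathbf 1_q+\boldsymbol a)\,(\boldsymbol\beta+(1-z)\mathbf 1_p)_{\boldsymbol m},$$ equivalently $\sum_{h=1}^q\sum_{k=0}^{\eta_h-1}d_{h,k}(z\mathbf 1_q+\boldsymbol a)_k(z+k)^{h-1}=(\boldsymbol\beta+(1-z)\mathbf 1_p)_{\boldsymbol m}$, where $d_{h,k}$ is the coefficient of $x^k$ in $D^{(h)}_{\boldsymbol\eta,\boldsymbol m}$. *)

(* Defs.v *)
From HB Require Import structures.
From mathcomp Require Export all_boot all_order all_algebra.
From mathcomp Require Export complex.
From mathcomp Require Export all_classical all_reals all_analysis.
Export Order.TTheory GRing.Theory Num.Theory.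
Export numFieldNormedType.Exports.

Global Set Implicit Arguments.
Global Unset Strict Implicit.
Global Unset Printing Implicit Defensive.

Global Open Scope classical_set_scope.
Global Open Scope complex_scope.
Global Open Scope ring_scope.

(* Indices are 0-based: l in {1, .., q} becomes l - 1 in 'I_q, so that the
   function v_h = D^(h-1) w0 is [euler_weight a (h - 1)] below. *)

Definition poch (A : nzRingType) (c : A) (k : nat) : A := \prod_(j < k) (c + j%:R).

Definition step_line (q : nat) (eta : 'I_q -> nat) : Prop :=
  (forall i j : 'I_q, (i <= j)%N -> (eta j <= eta i)%N) /\
  (forall i j : 'I_q, (eta i <= (eta j).+1)%N).

Section Mellin.
Context {R : realType}.

Definition gamma_weight (b : R) (x : R) : R := x `^ b * expR (- x).

Definition mellin_conv (f g : R -> R) (x : R) : R :=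
  \int[lebesgue_measure]_(t in `]0, +oo[) (f t * g (x / t) / t).

(* [w0 [:: b1; ..; bq]] is G_b1 * .. * G_bq; only nonempty lists matter, and
   all the functions here are only used on the half-line (0, +oo). *)
Definition w0 (s : seq R) : R -> R :=
  if s is b :: s' then
    foldl (fun f c => mellin_conv f (gamma_weight c)) (gamma_weight b) s'
  else cst 0.

Definition euler_op (f : R -> R) (x : R) : R := - x * f^`()%classic x.

(* x ^ s for x > 0 and s complex *)
Definition cpow (x : R) (s : R[i]) : R[i] :=
  (x `^ complex.Re s)%:C *
  (cos (complex.Im s * ln x) +i* sin (complex.Im s * ln x)).

Definition cintegrable (F : R -> R[i]) : Prop :=
  (@lebesgue_measure R).-integrable `]0, +oo[ (EFin \o (fun x => complex.Re (F x))) /\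
  (@lebesgue_measure R).-integrable `]0, +oo[ (EFin \o (fun x => complex.Im (F x))).

Definition cintegral (F : R -> R[i]) : R[i] :=
  (\int[lebesgue_measure]_(x in `]0, +oo[) complex.Re (F x)) +i*
  (\int[lebesgue_measure]_(x in `]0, +oo[) complex.Im (F x)).

Definition mellin_integrand (F : R -> R[i]) (z : R[i]) (x : R) : R[i] :=
  cpow x (z - 1) * F x.

(* Euler's integral; used for Re z > 0 *)
Definition cGamma (z : R[i]) : R[i] :=
  cintegral (mellin_integrand (fun x => (expR (- x))%:C) z).

End Mellin.

Section EulerComponents.
Context {R : realType} {p q : nat}.
Variables (a : 'rV[R]_q) (beta : 'rV[R]_p) (eta : 'I_q -> nat) (m : 'I_p -> nat).

Definition euler_weight (h : nat) : R -> R :=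
  iter h euler_op (w0 [seq a ord0 i | i <- enum 'I_q]).

Definition euler_form (D : 'I_q -> {poly R[i]}) (x : R) : R[i] :=
  \sum_(h < q) (D h).[x%:C] * (euler_weight h x)%:C.

(* The Mellin identity is required for all complex z in the half-plane
   Re z > max_i (- a_i), where the Gamma factors are given by Euler's
   integral and the Mellin transforms of the v_h converge absolutely. *)
Definition pure_euler_components (D : 'I_q -> {poly R[i]}) : Prop :=
  (forall h, (size (D h) <= eta h)%N) /\
  (forall z : R[i], (forall i, 0 < complex.Re z + a ord0 i) ->
     cintegrable (mellin_integrand (euler_form D) z) /\
     cintegral (mellin_integrand (euler_form D) z) =
       (\prod_(i < q) cGamma (z + (a ord0 i)%:C)) *
       (\prod_(i < p) poch ((beta ord0 i)%:C + (1 - z)) (m i))).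

End EulerComponents.

Section Coefficients.
Context {R : realType}.

Definition hypergeometric (A B : seq R) (x : R) : R :=
  limn (series (fun k : nat =>
    (\prod_(u <- A) poch u k) / (\prod_(v <- B) poch v k) * (x ^+ k / k`!%:R))).

(* Divided difference of a polynomial at the nodes [s], ordinary or confluent:
   the remainder of f modulo prod (X - x) is its Hermite interpolant at [s]
   (nodes counted with multiplicity), and the divided difference is the
   coefficient of degree (size s).-1 of that interpolant. *)
Definition divided_difference (f : {poly R}) (s : seq R) : R :=
  (f %% \prod_(x <- s) ('X - x%:P))`_(size s).-1.

(* e_j (a_1, .., a_l), for the first l entries of a *)
Definition esym (q : nat) (a : 'rV[R]_q) (l j : nat) : R :=
  \sum_(S : {set 'I_q} | (S \subset [set s : 'I_q | (s < l)%N]%SET) && (#|S| == j))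
    \prod_(s in S) a ord0 s.

Definition non_resonant (q : nat) (a : 'rV[R]_q) : Prop :=
  forall rho sigma : 'I_q, rho != sigma ->
    a ord0 rho - a ord0 sigma \isn't a Num.int.

Definition lattice_nodes (q : nat) (a : 'rV[R]_q) (k : nat) (l : 'I_q) : seq R :=
  [seq - a ord0 rho - j%:R | j <- iota 0 k, rho <- enum 'I_q] ++
  [seq - a ord0 rho - k%:R | rho : 'I_q <- enum 'I_q & (rho <= l)%N].

Definition multi_K (q : nat) (k : nat) (l sigma : 'I_q) : nat :=
  if (sigma <= l)%N then k.+1 else k.

Section Explicit.
Context {p q : nat}.
Variables (beta : 'rV[R]_p) (m : 'I_p -> nat).

(* P(z) = (beta + (1 - z) 1_p)_m *)
Definition beta_poly : {poly R} :=
  \prod_(i < p) poch ((beta ord0 i)%:P + (1 - 'X)) (m i).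

Definition c_explicit (a : 'rV[R]_q) (k : nat) (l : 'I_q) : R :=
  let K := multi_K k l in
  \sum_(rho < q | (1 <= K rho)%N)
    let n := (K rho).-1 in
    let B := fun i : 'I_p => beta ord0 i + a ord0 rho + 1 in
    let C := fun sigma : 'I_q => a ord0 sigma - a ord0 rho in
    (\prod_(i < p) poch (B i) (m i)) /
      (n`!%:R * \prod_(sigma < q | sigma != rho) poch (C sigma) (K sigma)) *
    hypergeometric
      (- n%:R :: [seq B i + (m i)%:R | i <- enum 'I_p] ++
         [seq 1 - C sigma - (K sigma)%:R | sigma <- enum 'I_q & sigma != rho])
      ([seq B i | i <- enum 'I_p] ++
         [seq 1 - C sigma | sigma <- enum 'I_q & sigma != rho])
      1.

Variables (a : 'rV[R]_q) (eta : 'I_q -> nat).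

Definition d_coef (c : nat -> 'I_q -> R) (h : 'I_q) (k : nat) : R :=
  \sum_(l < q | (h <= l)%N)
    esym a l (l - h) * (if (k < eta l)%N then c k l else 0).

Definition component_poly (c : nat -> 'I_q -> R) (h : 'I_q) : {poly R[i]} :=
  \poly_(k < eta h) (d_coef c h k)%:C.

End Explicit.
End Coefficients.

(* Main.v *)
(* Expanding the Mellin identity along z and dividing by the (nonzero) Gamma
   factors, the components are the coefficients of
   P(z) = (beta + (1 - z) 1_p)_m in the functions (z 1_q + a)_k (z + k)^h.  On
   the step-line these have pairwise distinct degrees, hence the coefficients
   are unique.  They exist because Newton interpolation of P at the lattice
   nodes -a_1, .., -a_q, -a_1 - 1, .. has the divided differences c_(k,l) as
   coefficients, and prod_(s < l) (z + k + a_s) expands in powers of z + k with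
   elementary symmetric coefficients.  Lagrange's formula for a divided
   difference at distinct nodes is the terminating hypergeometric sum, and the
   confluent case follows since divided differences are continuous in the nodes.

   For the Mellin transform of v_h: w0 is a convolution f * G_c, and the Euler
   operator acts on the last factor only, with
   euler_op (f * G_c) = f * G_(c + 1) - c (f * G_c).  So v_h is a combination of
   the positive functions f * G_(c + j), to which Fubini applies, and
   Gamma (z + 1) = z Gamma z turns the combination into z^h. *)

(* Defining a divided difference by a remainder makes sense when nodes coalesce, and the Newton
   expansion is proved for arbitrary node sequences. Hence one statement,
   [pure_euler_components_divided_difference], serves resonant and non-resonant [a] alike;
   distinctness of the nodes enters only through Lagrange's formula for [c_explicit]. On the
   step-line the pairs (k, l) with [k < eta l] correspond to the integers [q * k + l] below |eta|,
   so the Newton expansion ends exactly where the degree bounds on the components do. Dividing by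
   the Gamma factors seems to call for zero-freeness of Gamma in a half-plane. This is avoided: two
   polynomials in z are compared, so the integers z >= 2 suffice, and there all Gamma arguments are
   real and at least 1, where a lower bound of Euler's integral is elementary. Fubini is applied to
   the real and imaginary parts of x^(z-1), both dominated by x^(Re z - 1); the multiplicativity of
   the complex power is used only afterwards, when the inner integrals are recombined. *)
Require Import Defs.
From mathcomp Require Import ring lra zify measurable_realfun.

(** * Newton interpolation and divided differences *)

Section Newton.
Context {F : fieldType}.
Implicit Types (f : {poly F}) (x : nat -> F).

Definition newton_poly x n : {poly F} := \prod_(i < n) ('X - (x i)%:P).

Lemma newton_polyS x n : newton_poly x n.+1 = newton_poly x n * ('X - (x n)%:P).
Proof. exact: big_ord_recr. Qed.

Lemma monic_newton_poly x n : newton_poly x n \is monic.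
Proof. exact: monic_prod_XsubC. Qed.

Lemma size_newton_poly x n : size (newton_poly x n) = n.+1.
Proof. by rewrite size_prod_XsubC /index_enum -enumT size_enum_ord. Qed.

Lemma size_modp_newton f x n : (size (f %% newton_poly x n)%R <= n)%N.
Proof.
by rewrite -ltnS -(size_newton_poly x n) ltn_modp monic_neq0 ?monic_newton_poly.
Qed.

(** Both remainders are congruent to [f] modulo [newton_poly x n], so their difference is a multiple
    of it; having degree at most n, it is a scalar multiple, and the scalar is read off in degree n.
    Repeated nodes are covered. *)
Lemma modp_newton_step f x n :
  f %% newton_poly x n.+1 - f %% newton_poly x n =
  (f %% newton_poly x n.+1)`_n *: newton_poly x n.
Proof.
set g := _ - _.
have dg : newton_poly x n %| g.
  have -> : g = (f - f %% newton_poly x n) - (f - f %% newton_poly x n.+1).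
    by rewrite /g; ring.
  rewrite dvdp_sub //; first by rewrite {1}(divp_eq f (newton_poly x n)) addrK dvdp_mulIr.
  rewrite {1}(divp_eq f (newton_poly x n.+1)) addrK.
  by rewrite newton_polyS mulrCA dvdp_mulr ?dvdp_mulIl // mulrC.
have sg : (size g <= n.+1)%N.
  rewrite (leq_trans (size_polyD _ _)) // size_polyN geq_max size_modp_newton.
  by rewrite (leq_trans (size_modp_newton _ _ _)).
have [g0|gn0] := eqVneq g 0.
  have gn : g`_n = 0 by rewrite g0 coef0.
  move: gn; rewrite /g coefB (nth_default 0 (size_modp_newton f x n)) subr0 => ->.
  by rewrite scale0r.
move: dg => /dvdpP[h gE].
have hn0 : h != 0 by apply: contraNneq gn0 => h0; rewrite gE h0 mul0r.
have sh : (size h <= 1)%N.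
  move: sg; rewrite gE size_Mmonic ?monic_newton_poly// size_newton_poly addnS /=.
  by rewrite -[X in (_ <= X)%N]add1n leq_add2r.
have -> : (f %% newton_poly x n.+1)`_n = g`_n.
  by rewrite coefB (nth_default 0 (size_modp_newton f x n)) subr0.
rewrite gE (size1_polyC sh) mul_polyC coefZ.
have /monicP := monic_newton_poly x n; rewrite lead_coefE size_newton_poly => ->.
by rewrite mulr1.
Qed.

(** Telescoping: the remainder is 0 modulo the empty product and is [f] itself once the modulus has
    degree N. *)
Lemma newton_expansion f x N : (size f <= N)%N ->
  f = \sum_(n < N) (f %% newton_poly x n.+1)`_n *: newton_poly x n.
Proof.
move=> fN; under eq_bigr do rewrite -modp_newton_step.
rewrite -(big_mkord xpredT (fun n => f %% newton_poly x n.+1 - f %% newton_poly x n)).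
rewrite telescope_sumr// modp_small ?size_newton_poly//.
by rewrite [X in _ - _ %% X]big_ord0 modp1 subr0.
Qed.

End Newton.

(** * Lagrange's formula, the recursion of divided differences, and polynomials of distinct
    degrees *)

Section DividedDifferences.
Context {F : fieldType}.
Implicit Types (f : {poly F}) (s : seq F).

(** The remainder and the Lagrange interpolant [g] have size at most [size s] and agree at the
    [size s] distinct nodes, so they coincide. Each [L x] is monic of degree [(size s).-1], so only
    the weights survive in that coefficient. *)
Lemma coef_modp_lagrange f s : uniq s -> s != [::] ->
  (f %% \prod_(x <- s) ('X - x%:P))`_(size s).-1 =
  \sum_(x <- s) f.[x] / \prod_(y <- s | y != x) (x - y).
Proof.
move=> us s0; have s_gt0 : (0 < size s)%N by rewrite lt0n size_eq0.
pose L x : {poly F} := \prod_(y <- s | y != x) ('X - y%:P).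
pose g := \sum_(x <- s) (f.[x] / \prod_(y <- s | y != x) (x - y)) *: L x.
have sL x : x \in s -> size (L x) = size s.
  move=> xs; rewrite /L -big_filter size_prod_XsubC size_filter.
  have := count_predC (pred1 x) s; rewrite -/(count_mem x s) count_uniq_mem// xs add1n => <-.
  by congr S; apply: eq_count.
have mL x : L x \is monic by rewrite /L -big_filter monic_prod_XsubC.
have sg : (size g <= size s)%N.
  rewrite /g big_seq; elim/big_ind: _ => [|u v hu hv|x xs].
  - by rewrite size_poly0.
  - by rewrite (leq_trans (size_polyD _ _))// geq_max hu.
  - by rewrite (leq_trans (size_scale_leq _ _))// sL.
have gx x : x \in s -> g.[x] = f.[x].
  move=> xs; rewrite /g horner_sum (bigD1_seq x)//= [X in _ + X]big1 ?addr0.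
    rewrite hornerZ /L horner_prod; under [X in _ * X]eq_bigr do rewrite hornerXsubC.
    rewrite divfK// prodf_seq_neq0; apply/allP => y _; apply/implyP.
    by rewrite subr_eq0 eq_sym.
  move=> y yx; rewrite hornerZ /L horner_prod.
  rewrite [X in _ * X](_ : _ = 0) ?mulr0//.
  rewrite -big_filter (bigD1_seq x) ?filter_uniq//= ?mem_filter ?xs ?andbT 1?eq_sym//.
  by rewrite hornerXsubC subrr mul0r.
have -> : f %% \prod_(x <- s) ('X - x%:P) = g.
  set pi := \prod_(x <- s) _.
  have spi : size pi = (size s).+1 by rewrite size_prod_XsubC.
  apply/eqP; rewrite -subr_eq0; apply/eqP.
  apply: (@roots_geq_poly_eq0 _ _ s) => //.
    apply/allP => x xs; rewrite /root hornerD hornerN gx//.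
    rewrite [in X in _ - X](divp_eq f pi) hornerD hornerM.
    have -> : pi.[x] = 0.
      by rewrite /pi horner_prod (bigD1_seq x)//= hornerXsubC subrr mul0r.
    by rewrite mulr0 add0r subrr.
  rewrite (leq_trans (size_polyD _ _))// size_polyN geq_max sg andbT.
  rewrite -ltnS -spi ltn_modp -size_poly_eq0 spi//.
rewrite /g coef_sum big_seq [RHS]big_seq; apply: eq_bigr => x xs.
have /monicP := mL x; rewrite lead_coefE sL// coefZ => ->.
by rewrite mulr1.
Qed.

(** The recursion for divided differences, written with the quotient by ['X - x%:P] instead of a
    quotient of differences, so that it also holds at confluent nodes. If h is that quotient, the
    remainder of [f] is (h %% pi)('X - x) plus a constant, and both have the same top
    coefficient. *)
Lemma coef_modp_XsubC_cons f x s : s != [::] ->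
  (f %% \prod_(y <- x :: s) ('X - y%:P))`_(size s) =
  ((f %/ ('X - x%:P)) %% \prod_(y <- s) ('X - y%:P))`_(size s).-1.
Proof.
move=> s0; rewrite big_cons; set pi := \prod_(y <- s) _.
have s_gt0 : (0 < size s)%N by rewrite lt0n size_eq0.
have spi : size pi = (size s).+1 by rewrite size_prod_XsubC.
have pi0 : pi != 0 by rewrite -size_poly_eq0 spi.
have X0 : 'X - x%:P != 0 :> {poly F} by rewrite polyXsubC_eq0.
have spx : size (('X - x%:P) * pi) = (size s).+2 by rewrite size_mul// size_XsubC spi.
set h := f %/ ('X - x%:P).
have -> : f %% (('X - x%:P) * pi) = (h %% pi) * ('X - x%:P) + f %% ('X - x%:P).
  rewrite [X in X %% (_ * pi)](divp_eq f ('X - x%:P)) -/h [X in X * _](divp_eq h pi) mulrDl -mulrA.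
  rewrite [pi * _]mulrC -!addrA modpD modp_mull add0r modp_small// spx.
  rewrite (leq_ltn_trans (size_polyD _ _))// gtn_max.
  have hs : (size (h %% pi)%R <= size s)%N by rewrite -ltnS -spi ltn_modp.
  have fs : (size (f %% ('X - x%:P))%R <= 1)%N.
    by rewrite -ltnS -[X in (_ < X)%N](size_XsubC x) ltn_modp.
  rewrite (leq_ltn_trans fs) ?ltnS// andbT.
  by rewrite (leq_trans (size_polyMleq _ _))// size_XsubC addn2.
have fs : (size (f %% ('X - x%:P))%R <= 1)%N.
  by rewrite -ltnS -[X in (_ < X)%N](size_XsubC x) ltn_modp.
rewrite coefD [X in _ + X]nth_default ?addr0; last by rewrite (leq_trans fs).
rewrite mulrBr coefB coefMX coefMC eqn0Ngt s_gt0 /=.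
rewrite [X in _ - X * _]nth_default ?mul0r ?subr0//.
by rewrite -ltnS -spi ltn_modp.
Qed.

(** Horner's scheme: [Q] collects the values at [c] of the successive tails of [f]. This exhibits
    each coefficient of the quotient as a polynomial in [c]. *)
Lemma coef_divp_XsubC f c i : (f %/ ('X - c%:P))`_i = (drop_poly i.+1 f).[c].
Proof.
pose Q : {poly F} := \poly_(j < size f) (drop_poly j.+1 f).[c].
have QE j : Q`_j = (drop_poly j.+1 f).[c].
  rewrite coef_poly; case: ltnP => // fj.
  by rewrite drop_poly_eq0 ?horner0// ltnW.
have dropE j : (drop_poly j f).[c] = f`_j + c * (drop_poly j.+1 f).[c].
  have -> : drop_poly j f = (f`_j)%:P + drop_poly j.+1 f * 'X.
    apply/polyP => k; rewrite coefD coefMX coefC !coef_drop_poly.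
    by case: k => [|k] /=; rewrite ?add0n ?addr0 ?add0r ?addSnnS.
  by rewrite hornerD hornerC hornerMX mulrC.
have fE : f = Q * ('X - c%:P) + (f.[c])%:P.
  apply/polyP => j; rewrite coefD mulrBr coefB coefMX coefMC coefC !QE.
  case: j => [|j] /=.
    have := dropE 0%N; rewrite drop_poly0l => ->; ring.
  by rewrite addr0 dropE; ring.
have -> : f %/ ('X - c%:P) = Q; last exact: QE.
rewrite {1}fE divpD mulpK ?polyXsubC_eq0// divp_small ?addr0//.
by rewrite size_XsubC (leq_ltn_trans (size_polyC_leq1 _)).
Qed.

(** Among the terms with nonzero coefficient, the one of largest size has a leading term that no
    other term can cancel. *)
Lemma free_distinct_size (I : finType) (c : I -> F) (T : I -> {poly F}) :
  (forall i, T i != 0) -> injective (fun i => size (T i)) ->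
  \sum_i c i *: T i = 0 -> forall i, c i = 0.
Proof.
move=> T0 Tinj cT i; apply/eqP/negPn/negP => ci.
pose j := [arg max_(j > i | c j != 0) size (T j)].
have [cj jmax] : c j != 0 /\ forall k, c k != 0 -> (size (T k) <= size (T j))%N.
  by rewrite /j; case: arg_maxnP.
have := congr1 (fun f : {poly F} => f`_(size (T j)).-1) cT.
rewrite coef0 coef_sum (bigD1 j)//= big1 ?addr0.
  move/eqP; rewrite coefZ mulf_eq0 (negbTE cj) /= => /eqP h.
  by have := T0 j; rewrite -lead_coef_eq0 lead_coefE h eqxx.
move=> k kj; rewrite coefZ; have [->|ck] := eqVneq (c k) 0; first by rewrite mul0r.
rewrite nth_default ?mulr0//.
have : (size (T k) < size (T j))%N.
  rewrite ltn_neqAle jmax// andbT; apply: contra kj => /eqP/Tinj -> //.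
by case: (size (T j)).
Qed.

End DividedDifferences.

(** * Step-line indices *)

Section StepLine.
Context {q : nat}.
Variable eta : 'I_q -> nat.
Hypothesis heta : step_line eta.

(** [q * k + l] is the place of (k, l) in the row by row order. Both implications compare [eta]
    entrywise with the profile equal to k+1 on the first b indices and to k on the others: b = l+1
    bounds [eta] from below if [k < eta l], and b = l bounds it from above otherwise. *)
Lemma step_line_ltE (k : nat) (l : 'I_q) :
  (k < eta l)%N = (q * k + l < \sum_(h < q) eta h)%N.
Proof.
have [mono step] := heta.
have card (b : nat) : (b <= q)%N -> (\sum_(h < q) (k + (h < b)) = q * k + b)%N.
  move=> bq; rewrite big_split /= sum_nat_const card_ord; congr addn.
  rewrite (eq_bigr (fun h : 'I_q => if (h < b)%N then 1%N else 0%N)); last first.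
    by move=> h _; case: ltnP.
  by rewrite -big_mkcond /= -(big_ord_widen _ (fun=> 1%N))// sum1_card card_ord.
apply/idP/idP => [kl|]; last first.
  apply: contraTT; rewrite -!leqNgt => kl.
  rewrite -(card l (ltnW (ltn_ord l))); apply: leq_sum => h _.
  case: ltnP => /= [_|hl]; first by rewrite addn1 (leq_trans (step h l)).
  by rewrite addn0 (leq_trans (mono l h hl)).
rewrite -addnS -(card l.+1 (ltn_ord l)); apply: leq_sum => h _.
case: ltnP => /= [hl|_]; first by rewrite addn1 (leq_trans kl)// mono.
by rewrite addn0 -ltnS (leq_trans kl).
Qed.

(** Euclidean division by q splits n into l and k; [step_line_ltE] identifies the pairs that
    occur. *)
Lemma big_step_line (T : Type) (idx : T) (op : Monoid.com_law idx)
    (G : nat -> 'I_q -> T) (H : nat -> T) :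
  (forall k (l : 'I_q), (k < eta l)%N -> H (q * k + l)%N = G k l) ->
  \big[op/idx]_(n < \sum_(h < q) eta h) H n =
  \big[op/idx]_(l < q) \big[op/idx]_(k < eta l) G k l.
Proof.
move=> HG; set N := (\sum_(h < q) eta h)%N.
have etaN l : (eta l <= N)%N by rewrite /N (bigD1 l)//= leq_addr.
have ltE k (l : 'I_q) : (q * k + l < N)%N = (k < eta l)%N by rewrite step_line_ltE.
transitivity (\big[op/idx]_(l < q) \big[op/idx]_(k < N | (k < eta l)%N) G k l); last first.
  by apply: eq_bigr => l _; rewrite (big_ord_widen N (G ^~ l)).
have [N0|N0] := posnP N.
  rewrite N0 big_ord0 big1// => l _.
  by rewrite big_pred0// => -[].
have q0 : (0 < q)%N.
  by case: (posnP q) N0 => // q0; rewrite /N big1// => -[h hq]; exfalso; rewrite q0 in hq.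
pose h (n : 'I_N) : 'I_q * 'I_N :=
  (Ordinal (ltn_pmod n q0), Ordinal (leq_ltn_trans (leq_div n q) (ltn_ord n))).
(* The default value of [insubd] is never taken on a pair with [k < eta l], and only such pairs are
   summed over. *)
pose h' (u : 'I_q * 'I_N) : 'I_N := insubd (Ordinal N0) (q * u.2 + u.1)%N.
rewrite pair_big_dep /= (reindex_onto h h') /=; last first.
  move=> [l k] /= kl; rewrite /h /h'; congr (_, _); apply/val_inj => /=.
    by rewrite val_insubd ltE kl mulnC modnMDl modn_small.
  by rewrite val_insubd ltE kl mulnC divnMDl// divn_small ?addn0.
have hn (n : 'I_N) : (q * (n %/ q) + n %% q = n)%N by rewrite mulnC -divn_eq.
apply: eq_big => n.
  have -> : h' (h n) = n by apply: val_inj; rewrite val_insubd /= hn ltn_ord.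
  by rewrite eqxx andbT -ltE /= hn ltn_ord.
move=> _; rewrite -[in LHS](hn n) (HG _ (Ordinal (ltn_pmod n q0)))//.
by rewrite -ltE /= hn ltn_ord.
Qed.

End StepLine.

(** * Lattice nodes *)

Section LatticeNodes.
Context {R : realType} {q : nat}.
Implicit Types (a : 'rV[R]_q) (k : nat) (l : 'I_q).

(** Regroups the nodes by column [rho]. The row by row order suits the Newton expansion; the column
    order matches the outer sum of [c_explicit], with one hypergeometric series per column. *)
Lemma big_lattice_nodes (T : Type) (idx : T) (op : Monoid.com_law idx)
    a k l (P : pred R) (G : R -> T) :
  \big[op/idx]_(x <- lattice_nodes a k l | P x) G x =
  \big[op/idx]_(rho < q) \big[op/idx]_(j < multi_K k l rho | P (- a ord0 rho - j%:R))
     G (- a ord0 rho - j%:R).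
Proof.
have En : enum 'I_q = index_enum 'I_q by rewrite /index_enum -enumT.
rewrite /lattice_nodes !En big_cat big_mkcond big_allpairs_dep /= exchange_big /=.
rewrite [X in op _ X]big_map big_filter_cond /= big_mkcondr /= [X in op _ X]big_mkcond.
rewrite -big_split; apply: eq_bigr => rho _ /=.
have -> : iota 0 k = index_iota 0 k by rewrite /index_iota subn0.
rewrite big_mkord.
rewrite /multi_K; case: leqP => _; last by rewrite Monoid.mulm1 -big_mkcond.
by rewrite [RHS]big_mkcond big_ord_recr.
Qed.

(** The product $(z\mathbf 1_q+\boldsymbol a)_k$ as a polynomial in z; its roots are the first k
    complete rows of lattice nodes. *)
Definition coord_block a k : {poly R} :=
  \prod_(rho < q) poch ('X + (a ord0 rho)%:P) k.

Lemma prod_lattice_nodes a k l :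
  \prod_(x <- lattice_nodes a k l) ('X - x%:P) =
  coord_block a k * \prod_(s < q | (s <= l)%N) ('X + (a ord0 s)%:P + k%:R).
Proof.
have E rho j : 'X - (- a ord0 rho - j%:R)%:P = 'X + (a ord0 rho)%:P + j%:R :> {poly R}.
  by rewrite !(polyCN, polyCD) polyC_natr; ring.
rewrite big_lattice_nodes [X in _ * X]big_mkcond -big_split; apply: eq_bigr => rho _ /=.
rewrite /multi_K /poch; under eq_bigr do rewrite E.
by case: leqP => _; rewrite ?mulr1// big_ord_recr.
Qed.

Variable q0 : (0 < q)%N.

(** The infinite row by row enumeration of the lattice; [lattice_nodes a k l] is its initial segment
    ending at index [q * k + l]. *)
Definition lattice_node a (n : nat) : R :=
  - a ord0 (Ordinal (ltn_pmod n q0)) - (n %/ q)%:R.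

(** Row k is filled one factor at a time; after q factors each of the q Pochhammer products has
    gained one factor and the next row begins. *)
Lemma newton_poly_lattice_node a k (b : nat) : (b <= q)%N ->
  newton_poly (lattice_node a) (q * k + b) =
  coord_block a k * \prod_(s < q | (s < b)%N) ('X + (a ord0 s)%:P + k%:R).
Proof.
have step k' b' : (b' <= q)%N ->
    newton_poly (lattice_node a) (q * k') = coord_block a k' ->
    newton_poly (lattice_node a) (q * k' + b') =
    coord_block a k' * \prod_(s < q | (s < b')%N) ('X + (a ord0 s)%:P + k'%:R).
  move=> + Ek; elim: b' => [|b' IH] bq; first by rewrite addn0 Ek big_pred0// mulr1.
  rewrite addnS newton_polyS IH ?(ltnW bq)// -mulrA; congr (_ * _).
  pose s0 := Ordinal bq.
  rewrite [RHS](bigD1 s0)/= ?ltnSn// mulrC; congr (_ * _).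
    have -> : lattice_node a (q * k' + b') = - a ord0 s0 - k'%:R.
      rewrite /lattice_node; congr (- a _ _ - _%:R).
        by apply: val_inj; rewrite /= mulnC modnMDl modn_small.
      by rewrite mulnC divnMDl// divn_small// addn0.
    by rewrite polyCB polyCN polyC_natr; ring.
  by apply: eq_bigl => s; rewrite ltnS [in RHS]leq_eqVlt -val_eqE /=; case: ltngtP.
elim: k b => [|k IH] b bq; apply: step => //.
  rewrite muln0 /newton_poly big_ord0 /coord_block big1// => s _.
  by rewrite /poch big_ord0.
rewrite mulnSr IH// /coord_block [X in _ * X](eq_bigl xpredT); last by move=> s; rewrite ltn_ord.
by rewrite -big_split; apply: eq_bigr => s _ /=; rewrite /poch big_ord_recr.
Qed.

Lemma divided_difference_lattice a k l (f : {poly R}) :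
  divided_difference f (lattice_nodes a k l) =
  (f %% newton_poly (lattice_node a) (q * k + l).+1)`_(q * k + l).
Proof.
have E : \prod_(x <- lattice_nodes a k l) ('X - x%:P) =
     newton_poly (lattice_node a) (q * k + l).+1.
  by rewrite -addnS newton_poly_lattice_node ?ltn_ord// prod_lattice_nodes.
have S : size (lattice_nodes a k l) = (q * k + l).+1.
  by apply: succn_inj; rewrite -(size_prod_XsubC _ id) E size_newton_poly.
by rewrite /divided_difference S E.
Qed.

Lemma prod_shift_esym a l (y : {poly R}) :
  \prod_(s < q | (s < l)%N) (y + (a ord0 s)%:P) =
  \sum_(h < q | (h <= l)%N) esym a l (l - h) *: y ^+ h.
Proof.
pose L := [set s : 'I_q | (s < l)%N]%SET.
have cL : #|L| = l.
  rewrite -sum1_card (eq_bigl (fun s : 'I_q => (s < l)%N)); last by move=> s; rewrite inE.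
  by rewrite -(big_ord_widen _ (fun=> 1%N)) ?sum1_card ?card_ord// ltnW.
pose T (J : {set 'I_q}) := \prod_(s in J) a ord0 s *: y ^+ (l - #|J|).
transitivity (\sum_(J : {set 'I_q} | J \subset L) T J).
  rewrite big_mkcond.
  (* Indices s >= l get the trivial factor 0 + 1, so the product can be distributed over all subsets
     of ['I_q]; those not contained in [L] then contribute 0. *)
  pose A (s : 'I_q) : {poly R} := if (s < l)%N then (a ord0 s)%:P else 0.
  pose Y (s : 'I_q) : {poly R} := if (s < l)%N then y else 1.
  rewrite (eq_bigr (fun s => A s + Y s)); last first.
    by move=> s _; rewrite /A /Y; case: ifP; rewrite ?add0r// addrC.
  rewrite bigA_distr /= [RHS]big_mkcond; apply: eq_bigr => J _.
  case: (boolP (J \subset L)) => [JL|/subsetPn[s sJ sL]]; last first.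
    by rewrite (bigD1 s)//= sJ /A; move: sL; rewrite inE => /negbTE ->; rewrite mul0r.
  rewrite (bigID (mem J))/= /T -mul_polyC rmorph_prod; congr (_ * _).
    apply: eq_bigr => s sJ; rewrite sJ /A.
    by have := fintype.subsetP JL _ sJ; rewrite inE => ->.
  rewrite -cL -cardsDS// -prodr_const big_mkcond [RHS]big_mkcond.
  by apply: eq_bigr => s _; rewrite !inE /Y; case: (s \in J) => //=; case: ifP.
have pq (J : {set 'I_q}) : (l - #|J| < q)%N by rewrite (leq_ltn_trans (leq_subr _ _)).
rewrite (partition_big (fun J : {set 'I_q} => Ordinal (pq J)) (fun h : 'I_q => (h <= l)%N))/=; last first.
  by move=> J _; rewrite leq_subr.
apply: eq_bigr => h hl; rewrite /esym scaler_suml.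
apply: eq_big => [J|J /andP[_ /eqP <-]//].
case: (boolP (J \subset L)) => //= JL; have := subset_leq_card JL; rewrite cL -val_eqE /= => Jl.
by apply/eqP/eqP => [<-|->]; rewrite subKn.
Qed.

End LatticeNodes.

(** * The component identity *)

Section ComponentIdentity.
Context {R : realType} {p q : nat}.
Variables (a : 'rV[R]_q) (beta : 'rV[R]_p) (eta : 'I_q -> nat) (m : 'I_p -> nat).
Hypothesis heta : step_line eta.
Hypothesis hm : (\sum_(i < p) m i).+1 = (\sum_(h < q) eta h)%N.

(** The cofactor of $d_{h+1,k}$ in the coefficient form of the Mellin identity, as a polynomial in
    z; [h] counts from 0. *)
Definition euler_basis (h : nat) (k : nat) : {poly R} :=
  coord_block a k * ('X + k%:R) ^+ h.

Let q_gt0 : (0 < q)%N.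
Proof. by case: (q) eta hm => // f; rewrite big_ord0. Qed.

Lemma size_poch (A : nzRingType) (c : {poly A}) k : (size c <= 2)%N ->
  (size (poch c k) <= k.+1)%N.
Proof.
move=> c2; elim: k => [|k IH]; first by rewrite /poch big_ord0 size_poly1.
rewrite /poch big_ord_recr /= (leq_trans (size_polyMleq _ _))//.
have ck : (size (c + k%:R)%R <= 2)%N.
  by rewrite (leq_trans (size_polyD _ _))// geq_max c2 -polyC_natr (leq_trans (size_polyC_leq1 _)).
by rewrite -/(poch c k); move: (size (poch c k)) (size (c + k%:R)%R) IH ck => x y; lia.
Qed.

Lemma size_beta_poly : (size (beta_poly beta m) <= \sum_(h < q) eta h)%N.
Proof.
rewrite -hm /beta_poly (leq_trans (size_prod_leq _ _))//.
set S := (\sum_(i < p) size _)%N.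
have : (S <= \sum_(i < p) (m i).+1)%N.
  apply: leq_sum => i _; apply: size_poch.
  rewrite (leq_trans (size_polyD _ _))// geq_max (leq_trans (size_polyC_leq1 _))//=.
  by rewrite (leq_trans (size_polyD _ _))// size_polyN size_polyX size_poly1.
under eq_bigr do rewrite -addn1.
by rewrite big_split /= sum1_card card_ord; lia.
Qed.

Lemma monic_coord_block k : coord_block a k \is monic.
Proof.
apply: monic_prod => s _; apply: monic_prod => j _.
by rewrite -addrA -polyC_natr -polyCD monicXaddC.
Qed.

Lemma size_coord_block k : size (coord_block a k) = (q * k).+1.
Proof.
have := size_newton_poly (lattice_node q_gt0 a) (q * k + 0).
by rewrite newton_poly_lattice_node// big_pred0// mulr1 addn0.
Qed.

Lemma size_euler_basis h k : size (euler_basis h k) = (q * k + h).+1.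
Proof.
have X0 : 'X + k%:R \is @monic R by rewrite -polyC_natr monicXaddC.
rewrite /euler_basis size_Mmonic ?monic_exp ?monic_neq0 ?monic_coord_block//.
rewrite size_coord_block -polyC_natr -[k%:R]opprK polyCN size_exp_XsubC.
by rewrite addnS.
Qed.

Lemma newton_beta_poly (c : nat -> 'I_q -> R) :
  (forall k (l : 'I_q), (k < eta l)%N ->
     c k l = divided_difference (beta_poly beta m) (lattice_nodes a k l)) ->
  beta_poly beta m =
  \sum_(h < q) \sum_(k < eta h) d_coef a eta c h k *: euler_basis h k.
Proof.
move=> hc; set f := beta_poly beta m.
rewrite [LHS](newton_expansion (lattice_node q_gt0 a) size_beta_poly).
pose N k (l : 'I_q) : {poly R} := coord_block a k *
  \prod_(s < q | (s < l)%N) ('X + k%:R + (a ord0 s)%:P).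
pose x := lattice_node q_gt0 a.
rewrite (@big_step_line _ _ heta _ _ _ (fun k l => c k l *: N k l)
  (fun n => (f %% newton_poly x n.+1)`_n *: newton_poly x n)); last first.
  move=> k l kl; rewrite hc// divided_difference_lattice; congr (_ *: _).
  rewrite newton_poly_lattice_node ?(ltnW (ltn_ord l))//; congr (_ * _).
  by apply: eq_bigr => s _; rewrite addrAC.
pose M := (\sum_(h < q) eta h)%N.
have etaM l : (eta l <= M)%N by rewrite /M (bigD1 l)//= leq_addr.
(* The ranges of k depend on l; padding them with zeros up to a common [M] allows the sums to be
   exchanged. *)
transitivity (\sum_(l < q) \sum_(k < M) \sum_(h < q | (h <= l)%N)
   (esym a l (l - h) * (if (k < eta l)%N then c k l else 0)) *: euler_basis h k).
  apply: eq_bigr => l _; rewrite (big_ord_widen M (fun k => c k l *: N k l))//.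
  rewrite big_mkcond; apply: eq_bigr => k _; case: ifP => kl.
    rewrite /N prod_shift_esym mulr_sumr scaler_sumr; apply: eq_bigr => h _.
    by rewrite -scalerAr scalerA mulrC.
  by rewrite big1// => h _; rewrite mulr0 scale0r.
rewrite exchange_big /= [RHS](eq_bigr (fun h : 'I_q =>
  \sum_(k < M) d_coef a eta c h k *: euler_basis h k)).
  rewrite [RHS]exchange_big; apply: eq_bigr => k _ /=.
  rewrite (exchange_big_dep xpredT)//=; apply: eq_bigr => h _.
  by rewrite /d_coef scaler_suml.
move=> h _; rewrite (big_ord_widen M (fun k => d_coef a eta c h k *: euler_basis h k))// big_mkcond.
apply: eq_bigr => k _; case: ltnP => // kh.
(* Since [eta] is nonincreasing, l >= h and k >= eta h force k >= eta l: the coefficients vanish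
   exactly where the degree bound of the h-th component requires it. *)
rewrite /d_coef big1 ?scale0r// => l hl.
by rewrite ltnNge (leq_trans (heta.1 h l hl) kh) mulr0.
Qed.

Local Notation toC := (map_poly (real_complex R)).

Lemma component_identityP (c : nat -> 'I_q -> R) (D : 'I_q -> {poly R[i]}) :
  (forall k (l : 'I_q), (k < eta l)%N ->
     c k l = divided_difference (beta_poly beta m) (lattice_nodes a k l)) ->
  (forall h, (size (D h) <= eta h)%N) ->
  \sum_(h < q) \sum_(k < eta h) (D h)`_k *: toC (euler_basis h k) =
    toC (beta_poly beta m) <->
  forall h, D h = component_poly a eta c h.
Proof.
move=> hc sD.
have E : toC (beta_poly beta m) = \sum_(h < q) \sum_(k < eta h)
    (component_poly a eta c h)`_k *: toC (euler_basis h k).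
  rewrite (newton_beta_poly hc) rmorph_sum; apply: eq_bigr => h _.
  rewrite rmorph_sum; apply: eq_bigr => k _.
  by rewrite /= map_polyZ coef_poly ltn_ord.
rewrite E; split=> [|DE]; last by apply: eq_bigr => h _; rewrite DE.
pose M := (\sum_(h < q) eta h)%N.
have etaM l : (eta l <= M)%N by rewrite /M (bigD1 l)//= leq_addr.
have wide (D' : 'I_q -> {poly R[i]}) : (forall h, (size (D' h) <= eta h)%N) ->
   \sum_(h < q) \sum_(k < eta h) (D' h)`_k *: toC (euler_basis h k) =
   \sum_(u : 'I_q * 'I_M) (D' u.1)`_u.2 *: toC (euler_basis u.1 u.2).
  move=> sD'; rewrite -(pair_big xpredT xpredT (fun (h : 'I_q) (k : 'I_M) =>
    (D' h)`_k *: toC (euler_basis h k)))/=; apply: eq_bigr => h _.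
  rewrite (big_ord_widen M (fun k => (D' h)`_k *: toC (euler_basis h k)))//.
  rewrite big_mkcond; apply: eq_bigr => k _; case: ltnP => // hk.
  by rewrite nth_default ?scale0r// (leq_trans (sD' h)).
have sC h : (size (component_poly a eta c h) <= eta h)%N by exact: size_poly.
rewrite !wide// => /eqP; rewrite -subr_eq0 -sumrB => /eqP DE h.
pose cf (u : 'I_q * 'I_M) := (D u.1)`_u.2 - (component_poly a eta c u.1)`_u.2.
have cf0 : forall u, cf u = 0.
  apply: (@free_distinct_size _ _ cf (fun u => toC (euler_basis u.1 u.2))).
  - by move=> u; rewrite map_poly_eq0 -size_poly_eq0 size_euler_basis.
  - move=> [h1 k1] [h2 k2] /=; rewrite !size_map_poly !size_euler_basis => -[] e.
    (* Division by q recovers k from the degree qk + h, because h < q. *)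
    have ek : k1 = k2 :> nat.
      by have := congr1 (divn^~ q) e; rewrite ![(q * _)%N]mulnC !divnMDl// !divn_small// !addn0.
    have eh : h1 = h2 :> nat by move: e; rewrite ek => /addnI.
    by congr (_, _); apply: val_inj.
  - by rewrite -[RHS]DE; apply: eq_bigr => u _; rewrite scalerBl.
apply/polyP => k; case: (ltnP k M) => kM.
  by apply/eqP; rewrite -subr_eq0; apply/eqP; exact: (cf0 (h, Ordinal kM)).
by rewrite !nth_default// ?(leq_trans (sC h)) ?(leq_trans (sD h)) ?(leq_trans (etaM h)).
Qed.

End ComponentIdentity.

(** * The explicit divided differences *)

Lemma poch_real_neq0 (R : realDomainType) (c : R) k : 0 < c -> poch c k != 0.
Proof.
move=> c0; apply/prodf_neq0 => j _; rewrite gt_eqF//.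
by rewrite (lt_le_trans c0)// lerDl.
Qed.

Lemma pochD (R : comNzRingType) (c : R) m n : poch c (m + n) = poch c m * poch (c + m%:R) n.
Proof.
rewrite /poch big_split_ord /=; congr (_ * _).
by apply: eq_bigr => j _; rewrite natrD addrA.
Qed.

Lemma poch_reflect (R : comNzRingType) (c : R) k : poch (c - k%:R) k = (-1) ^+ k * poch (1 - c) k.
Proof.
rewrite /poch (reindex_inj rev_ord_inj) /= (eq_bigr (fun j : 'I_k => - (1 - c + j%:R))).
  by rewrite prodrN card_ord.
by move=> j _; rewrite natrB// -natr1; ring.
Qed.

Lemma poch_oppn (R : comNzRingType) (n j : nat) : (j <= n)%N ->
  poch (- n%:R : R) j * (n - j)`!%:R = (-1) ^+ j * n`!%:R.
Proof.
elim: j => [|j IH] jn; first by rewrite /poch big_ord0 subn0 expr0.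
have := IH (ltnW jn); rewrite -[(n - j)%N]prednK ?subn_gt0// factS natrM -subnS.
have -> : ((n - j.+1).+1%:R : R) = n%:R - j%:R by rewrite subnSK// natrB// ltnW.
rewrite exprS -mulrA => <-; rewrite /poch big_ord_recr /=; ring.
Qed.

Lemma poch_oppn_eq0 (R : comNzRingType) (n j : nat) : (n < j)%N -> poch (- n%:R : R) j = 0.
Proof. by move=> nj; rewrite /poch (bigD1 (Ordinal nj))//= addNr mul0r. Qed.

(** The part of a Lagrange denominator that comes from the node's own column: the nodes before j
    give (-1)^j j!, those after it give (n-j)!. *)
Lemma prod_distance (R : comNzRingType) (n j : nat) : (j <= n)%N ->
  \prod_(i < n.+1 | i != j :> nat) (i%:R - j%:R) = (-1) ^+ j * (j`! * (n - j)`!)%:R :> R.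
Proof.
elim: n j => [|n IH] j.
  by case: j => // _; rewrite big_mkcond big_ord1/= subnn expr0 mul1r.
rewrite leq_eqVlt => /orP[/eqP -> |].
  rewrite big_mkcond big_ord_recr /= eqxx mulr1 subnn muln1.
  rewrite (eq_bigr (fun i : 'I_n.+1 => - (n.+1 - i)%:R)); last first.
    by move=> i _; rewrite ltn_eqF//= natrB 1?ltnW// opprB.
  rewrite prodrN card_ord; congr (_ * _); rewrite fact_prod natr_prod (reindex_inj rev_ord_inj)/=.
  by rewrite big_add1 big_mkord; apply: eq_bigr => i _; rewrite subKn.
rewrite ltnS => jn; rewrite big_mkcond big_ord_recr /= -big_mkcond IH//.
rewrite gtn_eqF ?ltnS//= subSn// factS -natrB ?(leqW jn)// -mulrA -natrM.
by congr (_ * _%:R); rewrite subSn//; lia.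
Qed.

Lemma horner_poch (R : comNzRingType) (f : {poly R}) (y : R) k :
  (poch f k).[y] = poch f.[y] k.
Proof.
rewrite horner_prod; apply: eq_bigr => j _.
by rewrite hornerD -polyC_natr hornerC.
Qed.

Section Explicit.
Context {R : realType} {p q : nat}.
Variables (beta : 'rV[R]_p) (m : 'I_p -> nat) (a : 'rV[R]_q).
Hypothesis hbeta : forall i rho, -1 < beta ord0 i + a ord0 rho.

(** The factor (-n)_k vanishes for k > n, so the partial sums are constant from n+1 on and the limit
    is that constant. *)
Lemma hypergeometric_terminating (A B : seq R) (n : nat) : 
  hypergeometric (- n%:R :: A) B 1 =
  \sum_(j < n.+1) poch (- n%:R) j * \prod_(u <- A) poch u j / (\prod_(v <- B) poch v j) / j`!%:R.
Proof.
rewrite /hypergeometric; apply: cvg_lim => //.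
apply: cvg_near_cst; exists n.+1 => // k /= nk.
rewrite /series /= (big_cat_nat (n := n.+1))//= [X in _ + X]big_nat_cond [X in _ + X]big1 ?addr0.
  by rewrite big_mkord; apply: eq_bigr => j _; rewrite big_cons expr1n mul1r.
move=> j /andP[/andP[nj _] _].
by rewrite big_cons poch_oppn_eq0// !mul0r.
Qed.

Lemma horner_beta_poly y :
  (beta_poly beta m).[y] = \prod_(i < p) poch (beta ord0 i + (1 - y)) (m i).
Proof.
rewrite horner_prod; apply: eq_bigr => i _; rewrite horner_poch; congr poch.
by rewrite !hornerD hornerN hornerC hornerX -polyC1 hornerC.
Qed.

Lemma lattice_node_inj (ha : non_resonant a) rho sigma (i j : nat) :
  - a ord0 rho - j%:R = - a ord0 sigma - i%:R -> rho = sigma /\ j = i.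
Proof.
move=> E; have [rs|rs] := eqVneq rho sigma.
  by split=> //; apply/eqP; rewrite -(eqr_nat R); apply/eqP; move: E; rewrite rs; lra.
exfalso; have /negP := ha _ _ rs; apply.
have -> : a ord0 rho - a ord0 sigma = i%:R - j%:R by lra.
by rewrite rpredB// Num.Theory.natr_int.
Qed.

Lemma uniq_lattice_nodes (ha : non_resonant a) k l : uniq (lattice_nodes a k l).
Proof.
rewrite cat_uniq; apply/and3P; split.
- apply: allpairs_uniq; [exact: iota_uniq|exact: enum_uniq|].
  by move=> [j s] [i t] _ _ /= /(lattice_node_inj ha)[-> ->].
- apply/hasPn => x /mapP[s _ ->]; apply/negP => /allpairsP[[j t]/= [+ _]].
  by rewrite mem_iota add0n => /andP[_ jk] /(lattice_node_inj ha)[_ kj]; move: jk; rewrite -kj ltnn.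
- rewrite map_inj_in_uniq; first exact/filter_uniq/enum_uniq.
  by move=> s t _ _ /(lattice_node_inj ha)[].
Qed.

(** Used for a column other than that of the node: it converts the denominator seen from node j into
    the one seen from node 0 times a ratio of hypergeometric type. Each K-fold product is split into
    blocks of lengths j and K-j; the blocks of length K-j agree and those of length j are reflected,
    with equal signs. *)
Lemma poch_factor (C : R) K j : (j <= K)%N -> poch (C - j%:R) K * poch (1 - C - K%:R) j =
  poch C K * poch (1 - C) j.
Proof.
move=> jK.
have P2 : poch C K = poch C (K - j) * poch (C + (K - j)%:R) j by rewrite -pochD subnK.
have P1 : poch (C - j%:R) K = poch (C - j%:R) j * poch C (K - j).
  by rewrite -{1}(subnKC jK) pochD subrK.
have := poch_reflect C j; have := poch_reflect (C + K%:R) j.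
have -> : C + K%:R - j%:R = C + (K - j)%:R by rewrite natrB//; ring.
have -> : 1 - (C + K%:R) = 1 - C - K%:R by ring.
by move=> E1 E2; rewrite P1 P2 E1 E2; ring.
Qed.

(** In Lagrange's formula the node $-a_\rho-j$ produces the j-th term of the series attached to
    [rho]: the value of P there gives the [B] parameters, the own column gives (-n)_j / j!, and the
    other columns give the [C] parameters. *)
Lemma c_explicit_divided_difference (ha : non_resonant a) k l :
  c_explicit beta m a k l = divided_difference (beta_poly beta m) (lattice_nodes a k l).
Proof.
have l0 : lattice_nodes a k l != [::].
  suff : - a ord0 l - k%:R \in lattice_nodes a k l by case: lattice_nodes.
  by rewrite mem_cat; apply/orP; right; apply: map_f; rewrite mem_filter leqnn mem_enum.
rewrite /divided_difference coef_modp_lagrange ?uniq_lattice_nodes// big_lattice_nodes.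
rewrite /c_explicit [LHS]big_mkcond; apply: eq_bigr => rho _ /=.
(* A column without nodes contributes 0 to Lagrange's sum and is excluded from [c_explicit] by its
   side condition. *)
case: (posnP (multi_K k l rho)) => [->|K0]; first by rewrite big_ord0.
set n := (multi_K k l rho).-1.
have nK : multi_K k l rho = n.+1 by rewrite prednK.
rewrite hypergeometric_terminating mulr_sumr nK; apply: eq_bigr => j _.
have jn : (j <= n)%N by rewrite -ltnS.
rewrite horner_beta_poly.
pose B (i : 'I_p) := beta ord0 i + a ord0 rho + 1.
pose C (s : 'I_q) := a ord0 s - a ord0 rho.
have B0 i : 0 < B i by rewrite /B -ltrBlDr sub0r.
(* Non-resonance: [C s] plus an integer is never 0, so none of these Pochhammer products
   vanishes. *)
have C0 s t (K : nat) : s != rho -> poch (C s - t%:R) K != 0 /\ poch (1 - C s) t != 0.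
  move=> sr; have Cint (z : R) : z \is a Num.int -> C s + z != 0.
    move=> zi; apply/negP; rewrite addr_eq0 => /eqP Cz.
    by have /negP := ha _ _ sr; apply; rewrite -/(C s) Cz rpredN.
  split; apply/prodf_neq0 => i _.
    by rewrite -addrA Cint// rpredD ?rpredN ?Num.Theory.natr_int.
  have -> : 1 - C s + i%:R = - (C s + (- 1 - i%:R)) by ring.
  rewrite oppr_eq0.
  by rewrite Cint// rpredD ?rpredN ?Num.Theory.natr_int ?rpred1.
(* Both (B+j)_m (B)_j and (B)_m (B+m)_j equal (B)_{m+j}; the division by (B)_j is licit because
   [hbeta] makes B positive. *)
have numE i : poch (beta ord0 i + (1 - (- a ord0 rho - j%:R))) (m i) =
    poch (B i) (m i) * poch (B i + (m i)%:R) j / poch (B i) j.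
  apply: canRL (mulfK _) _; first exact: poch_real_neq0.
  rewrite -pochD addnC pochD mulrC; congr (_ * poch _ _); rewrite /B; ring.
rewrite (eq_bigr _ (fun i _ => numE i)) big_split /= big_split /= prodfV.
have -> : \prod_(y <- lattice_nodes a k l | y != - a ord0 rho - j%:R) (- a ord0 rho - j%:R - y) =
  ((-1) ^+ j * (j`! * (n - j)`!)%:R) *
  \prod_(s < q | s != rho) poch (C s - j%:R) (multi_K k l s).
  rewrite big_lattice_nodes (bigD1 rho)//=; congr (_ * _).
    rewrite nK -(prod_distance _ jn); apply: eq_big => [i|i _]; last by ring.
    congr (~~ _); apply/eqP/eqP => [/(lattice_node_inj ha)[]//|->//].
  apply: eq_bigr => s sr; rewrite /poch big_mkcond; apply: eq_bigr => i _.
  rewrite ifT; first by rewrite /C; ring.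
  by apply/eqP => /(lattice_node_inj ha)[srho]; rewrite srho eqxx in sr.
have En I : enum 'I_I = index_enum 'I_I by rewrite /index_enum -enumT.
rewrite !En !big_cat !big_map !big_filter.
have denE s : s != rho -> poch (C s - j%:R) (multi_K k l s) =
   poch (C s) (multi_K k l s) * poch (1 - C s) j / poch (1 - C s - (multi_K k l s)%:R) j.
  (* Every column has k or k+1 nodes, so j <= n <= k <= [multi_K k l s]. *)
  move=> sr; have jK : (j <= multi_K k l s)%N.
    apply: leq_trans jn _; rewrite /n /multi_K.
    by case: ifP => _; case: ifP => _; rewrite ?leqnSn// (leq_trans (leq_pred _)).
  have E := poch_factor (C s) jK.
  (* The divisor (1-C-K)_j is nonzero because otherwise [E] would make the product (C)_K (1-C)_j
     vanish, against [C0]. *)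
  refine (canRL (mulfK _) E); apply/eqP => z; move: E; rewrite z mulr0 => /eqP.
  rewrite eq_sym mulf_eq0 (negbTE (C0 s j 0%N sr).2) orbF.
  by have := (C0 s 0%N (multi_K k l s) sr).1; rewrite subr0 => /negbTE ->.
rewrite (eq_bigr _ denE) big_split big_split /= prodfV.
have fj : (j`!%:R : R) != 0 by rewrite pnatr_eq0 -lt0n fact_gt0.
have fnj : ((n - j)`!%:R : R) != 0 by rewrite pnatr_eq0 -lt0n fact_gt0.
have fn : (n`!%:R : R) != 0 by rewrite pnatr_eq0 -lt0n fact_gt0.
have En1 := poch_oppn R jn.
have -> : poch (- n%:R : R) j = (-1) ^+ j * n`!%:R / (n - j)`!%:R.
  by apply: canRL (mulfK _) En1.
rewrite natrM.
have S2 : (-1) ^+ j != 0 :> R by rewrite signr_eq0.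
have S1 : ((-1) ^+ j)^-1 = (-1) ^+ j :> R by rewrite invr_sign.
rewrite !invfM !invrK S1.
set s1 := (-1) ^+ j; set x1 := \prod_(i < p) _; set x2 := \prod_(i < p) _.
set x3 := (\prod_(i < p) _)^-1.
set x4 := (\prod_(s < q | _) _)^-1; set x5 := (\prod_(s < q | _) _)^-1.
set x6 := \prod_(s < q | _) _.
rewrite mulrA.
by field; rewrite ?fj ?fnj ?fn.
Qed.

End Explicit.

(** * Continuity of divided differences *)

Section Continuity.
Context {R : realType} {T : Type} (Fl : set_system T) {FF : Filter Fl}.

Lemma cvg_sumr (I : Type) (r : seq I) (f : I -> T -> R) (g : I -> R) :
  (forall i, f i b @[b --> Fl] --> g i) ->
  \sum_(i <- r) f i b @[b --> Fl] --> \sum_(i <- r) g i.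
Proof.
move=> fg; elim: r => [|i r IH].
  by rewrite big_nil; under eq_fun do rewrite big_nil; exact: cvg_cst.
rewrite big_cons; under eq_fun do rewrite big_cons.
exact: cvgD.
Qed.

Lemma cvg_exprn (f : T -> R) (g : R) n :
  f b @[b --> Fl] --> g -> f b ^+ n @[b --> Fl] --> g ^+ n.
Proof.
move=> fg; elim: n => [|n IH].
  by rewrite expr0; under eq_fun do rewrite expr0; exact: cvg_cst.
by rewrite exprS; under eq_fun do rewrite exprS; exact: cvgM.
Qed.

(** The common bound [N] on the sizes turns evaluation into one fixed finite sum of products. *)
Lemma cvg_horner (F : T -> {poly R}) (G : {poly R}) (N : nat) (x : T -> R) (y : R) :
  (forall b, (size (F b) <= N)%N) -> (size G <= N)%N ->
  (forall i, (F b)`_i @[b --> Fl] --> G`_i) -> x b @[b --> Fl] --> y ->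
  (F b).[x b] @[b --> Fl] --> G.[y].
Proof.
move=> sF sG FG xy; rewrite (horner_coef_wide _ sG).
under eq_fun do rewrite (horner_coef_wide _ (sF _)).
by apply: cvg_sumr => i; apply: cvgM => //; exact: cvg_exprn.
Qed.

(* Dividing by 'X - x drops the node x from a divided difference, and the
   coefficients of the quotient are polynomials in x. *)
Lemma cvg_divided_difference (I : Type) (x : I -> T -> R) (y : I -> R) (s : seq I)
    (F : T -> {poly R}) (G : {poly R}) (N : nat) :
  (forall i, x i b @[b --> Fl] --> y i) ->
  (forall b, (size (F b) <= N)%N) -> (size G <= N)%N ->
  (forall i, (F b)`_i @[b --> Fl] --> G`_i) ->
  divided_difference (F b) [seq x i b | i <- s] @[b --> Fl] -->
  divided_difference G [seq y i | i <- s].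
Proof.
move=> xy; elim: s F G => [|i s IH] F G sF sG FG.
  have E f : divided_difference f [::] = 0 :> R.
    by rewrite /divided_difference big_nil modp1 coef0.
  by rewrite /= E; under eq_fun do rewrite E; exact: cvg_cst.
(* The recursion requires a nonempty tail; for a single node the divided difference is the value of
   the polynomial there. *)
case: s IH => [|j s] IH.
  have E f u : divided_difference f [:: u] = f.[u] :> R.
    by rewrite /divided_difference big_seq1 modp_XsubC coefC.
  rewrite /= E; under eq_fun do rewrite E.
  exact: (cvg_horner sF sG).
have E f (u v : R) t : divided_difference f [:: u, v & t] =
    divided_difference (f %/ ('X - u%:P)) (v :: t).
  exact: (@coef_modp_XsubC_cons _ f u (v :: t) isT).
rewrite /= E; under eq_fun do rewrite E.
apply: IH.
- by move=> b; rewrite (leq_trans _ (sF b))// size_divp ?polyXsubC_eq0// leq_subr.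
- by rewrite (leq_trans _ sG)// size_divp ?polyXsubC_eq0// leq_subr.
move=> n; rewrite coef_divp_XsubC; under eq_fun do rewrite coef_divp_XsubC.
apply: (@cvg_horner _ _ N) => //.
- by move=> b; rewrite size_drop_poly (leq_trans (leq_subr _ _)).
- by rewrite size_drop_poly (leq_trans (leq_subr _ _)).
by move=> e; rewrite coef_drop_poly; under eq_fun do rewrite coef_drop_poly; exact: FG.
Qed.

End Continuity.

Section LatticeContinuity.
Context {R : realType} {p q : nat}.

Lemma cvg_divided_difference_lattice (f : {poly R}) (k : nat) (l : 'I_q) (a : 'rV[R]_q) :
  divided_difference f (lattice_nodes b k l) @[b --> a] -->
  divided_difference f (lattice_nodes a k l).
Proof.
have Fa : Filter (nbhs a) by exact: nbhs_filter.
pose x (u : nat * 'I_q) (b : 'rV[R]_q) := - b ord0 u.2 - u.1%:R.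
pose s := [seq (j, rho) | j <- iota 0 k, rho <- enum 'I_q] ++
  [seq (k, rho) | rho : 'I_q <- enum 'I_q & (rho <= l)%N].
have xE b : lattice_nodes b k l = [seq x u b | u <- s].
  by rewrite /s map_cat map_allpairs -map_comp.
rewrite xE; under eq_fun do rewrite xE.
apply: (@cvg_divided_difference _ _ (nbhs a) _ _ x (x ^~ a) s (cst f) f (size f)) => //; last first.
  by move=> i; apply: cvg_cst.
move=> u; apply: (@cvgB _ _ _ _ _ (fun b : 'rV[R]_q => - b ord0 u.2) (cst u.1%:R)); last first.
  by apply: cvg_cst.
apply: (@cvgN _ _ _ _ _ (fun b : 'rV[R]_q => b ord0 u.2)); exact: coord_continuous.
Qed.

(** At non-resonant points near [a] the explicit formula is the divided difference, which is
    continuous at every [a], resonant or not. *)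
Lemma c_explicit_cvg (beta : 'rV[R]_p) (m : 'I_p -> nat) (a : 'rV[R]_q) k (l : 'I_q) :
  (forall i rho, -1 < beta ord0 i + a ord0 rho) ->
  c_explicit beta m b k l @[b --> within [set b | non_resonant b] (nbhs a)] -->
  divided_difference (beta_poly beta m) (lattice_nodes a k l).
Proof.
move=> hb; have Fa : Filter (nbhs a) by exact: nbhs_filter.
(* The finitely many strict inequalities of [hbeta] persist in a neighbourhood of [a]. *)
have nb : \forall b \near nbhs a, forall (i : 'I_p) (rho : 'I_q),
    -1 < beta ord0 i + (b : 'rV[R]_q) ord0 rho.
  apply: (filter_forall Fa) => i; apply: (filter_forall Fa) => rho.
  have : (beta ord0 i + b ord0 rho) @[b --> nbhs a] --> beta ord0 i + a ord0 rho.
    apply: (@cvgD _ _ _ _ _ (cst (beta ord0 i)) (fun b : 'rV[R]_q => b ord0 rho)).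
      by apply: cvg_cst.
    exact: coord_continuous.
  by move=> /cvgr_gt; apply.
have dd := @cvg_divided_difference_lattice (beta_poly beta m) k l a.
apply: cvg_trans (cvg_within_filter _ dd).
apply: near_eq_cvg; apply: (filterS _ nb) => b hb' nr /=.
by rewrite c_explicit_divided_difference.
Qed.



End LatticeContinuity.

(** * Fubini and scaling on the half-line *)

Section FubiniDomains.
Context d1 d2 (T1 : measurableType d1) (T2 : measurableType d2) (R : realType).
Variables (m1 : {sigma_finite_measure set T1 -> \bar R})
          (m2 : {sigma_finite_measure set T2 -> \bar R}).
Variables (D1 : set T1) (D2 : set T2).
Hypotheses (mD1 : measurable D1) (mD2 : measurable D2).
Local Open Scope ereal_scope.
Implicit Type f : T1 * T2 -> \bar R.

Let mD : measurable (D1 `*` D2). Proof. exact: measurableX. Qed.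

(** Extending [f] by 0 outside the rectangle commutes with the inner integral, so the Fubini
    theorems on the whole product space transfer to [D1] and [D2]. *)
Let restrE1 f x : \int[m2]_y (f \_ (D1 `*` D2)) (x, y) =
  ((fun x => \int[m2]_(y in D2) f (x, y)) \_ D1) x.
Proof.
rewrite patchE; case: ifPn => xD; last first.
  rewrite integral0_eq// => y _; rewrite patchE ifF//.
  by apply/negbTE; apply: contra xD; rewrite !inE => -[].
rewrite [RHS]integral_mkcond; apply: eq_integral => y _; rewrite !patchE.
by rewrite in_setX xD.
Qed.

Let restrE2 f y : \int[m1]_x (f \_ (D1 `*` D2)) (x, y) =
  ((fun y => \int[m1]_(x in D1) f (x, y)) \_ D2) y.
Proof.
rewrite patchE; case: ifPn => yD; last first.
  rewrite integral0_eq// => x _; rewrite patchE ifF//.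
  by apply/negbTE; apply: contra yD; rewrite !inE => -[].
rewrite [RHS]integral_mkcond; apply: eq_integral => x _; rewrite !patchE.
by rewrite in_setX yD andbT.
Qed.

Let mrestr f : measurable_fun (D1 `*` D2) f ->
  measurable_fun [set: T1 * T2] (f \_ (D1 `*` D2)).
Proof. by move=> mf; apply/(measurable_restrictT _ mD). Qed.

Lemma fubini_tonelli_in f : measurable_fun (D1 `*` D2) f ->
  (forall z, (D1 `*` D2) z -> 0 <= f z) ->
  \int[m1]_(x in D1) \int[m2]_(y in D2) f (x, y) =
  \int[m2]_(y in D2) \int[m1]_(x in D1) f (x, y).
Proof.
move=> mf f0; rewrite [LHS]integral_mkcond [RHS]integral_mkcond.
under eq_integral do rewrite -restrE1.
under [RHS]eq_integral do rewrite -restrE2.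
apply: (fubini_tonelli (f \_ (D1 `*` D2))); first exact: mrestr.
by move=> z; apply: erestrict_ge0.
Qed.

Lemma measurable_fun_fubini_tonelli_F_in f : measurable_fun (D1 `*` D2) f ->
  (forall z, (D1 `*` D2) z -> 0 <= f z) ->
  measurable_fun D1 (fun x => \int[m2]_(y in D2) f (x, y)).
Proof.
move=> mf f0; apply/(measurable_restrictT _ mD1).
rewrite -(funext (restrE1 f)).
apply: (measurable_fun_fubini_tonelli_F (f \_ (D1 `*` D2))); first exact: mrestr.
by move=> z; apply: erestrict_ge0.
Qed.

Lemma measurable_fun_fubini_tonelli_G_in f : measurable_fun (D1 `*` D2) f ->
  (forall z, (D1 `*` D2) z -> 0 <= f z) ->
  measurable_fun D2 (fun y => \int[m1]_(x in D1) f (x, y)).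
Proof.
move=> mf f0; apply/(measurable_restrictT _ mD2).
rewrite -(funext (restrE2 f)).
apply: (measurable_fun_fubini_tonelli_G (f \_ (D1 `*` D2))); first exact: mrestr.
by move=> z; apply: erestrict_ge0.
Qed.

Lemma fubini_in f : measurable_fun (D1 `*` D2) f ->
  \int[m1]_(x in D1) \int[m2]_(y in D2) `|f (x, y)| < +oo ->
  \int[m1]_(x in D1) \int[m2]_(y in D2) f (x, y) =
  \int[m2]_(y in D2) \int[m1]_(x in D1) f (x, y).
Proof.
move=> mf foo; rewrite [LHS]integral_mkcond [RHS]integral_mkcond.
under eq_integral do rewrite -restrE1.
under [RHS]eq_integral do rewrite -restrE2.
apply: Fubini; apply/integrable12ltyP; first exact: mrestr.
suff -> : \int[m1]_x \int[m2]_y `|(f \_ (D1 `*` D2)) (x, y)| =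
  \int[m1]_(x in D1) \int[m2]_(y in D2) `|f (x, y)| by [].
rewrite [RHS]integral_mkcond; apply: eq_integral => x _.
rewrite -(restrE1 (abse \o f)); apply: eq_integral => y _.
by rewrite restrict_abse.
Qed.

End FubiniDomains.

Section HalfLine.
Context {R : realType}.
Local Notation mu := (@lebesgue_measure R).
Local Notation P := (`]0, +oo[%classic : set R).
Local Open Scope ereal_scope.

(** Lebesgue measure is 1/t times its pushforward under division by t: the two agree on the
    intervals ]a, b], which determine the measure. *)
Lemma ge0_integral_scale (t : R) (h : R -> \bar R) : (0 < t)%R ->
  measurable_fun P h -> (forall x, P x -> 0 <= h x) ->
  \int[mu]_(x in P) (h (x / t)%R * (t^-1)%:E) = \int[mu]_(x in P) h x.
Proof.
move=> t0 mh h0.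
pose k : {nonneg R} := NngNum (ltW (divr_gt0 ltr01 t0)).
pose phi := (fun x : R => x / t)%R : measurableTypeR R -> measurableTypeR R.
have mphi : measurable_fun [set: measurableTypeR R] phi.
  by apply: measurable_funM => //; exact: measurable_cst.
have phiP : phi @^-1` P = P.
  apply/seteqP; split=> x /=; rewrite !in_itv/= !andbT /phi.
    by rewrite pmulr_lgt0// invr_gt0.
  by move=> x0; rewrite divr_gt0.
have E A : measurable A -> mu A = mscale k (pushforward mu phi) A.
  move=> mA; apply: lebesgue_measure_unique => //.
  move=> _ [[a b]] _ <-; transitivity (k%:num%:E * mu (phi @^-1` `]a, b])) => //=.
  have -> : phi @^-1` `]a, b] = (`](a * t), (b * t)]%classic)%R.
    by apply/seteqP; split=> x /=; rewrite !in_itv/= /phi ltr_pdivlMr// ler_pdivrMr.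
  rewrite !lebesgue_measure_itv/= !lte_fin ltr_pM2r//.
  case: ifPn => _; last by rewrite mule0.
  by rewrite -!EFinB -EFinM; congr EFin; field; rewrite gt_eqF.
have mhphi : measurable_fun P (h \o phi).
  apply: (measurable_comp _ _ mh) => //.
    by move=> _ [x + <-]; rewrite -{1}phiP.
  exact: measurable_funS mphi.
rewrite ge0_integralZr//; last 2 first.
  by move=> x; rewrite -{1}phiP => /h0.
  by rewrite lee_fin invr_ge0 ltW.
rewrite muleC -[X in \int[_]_(x in X) _]phiP.
rewrite -(ge0_integral_pushforward mphi)//; last by move=> y; rewrite inE => /h0.
have -> : (t^-1)%:E = k%:num%:E by rewrite /= div1r.
rewrite -(ge0_integral_mscale _ _ k)//.
by apply: eq_measure_integral => A mA _; symmetry; exact: E.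
Qed.

Lemma integral_scale (t : R) (h : R -> R) : (0 < t)%R -> measurable_fun P h ->
  \int[mu]_(x in P) (h (x / t) / t)%:E = \int[mu]_(x in P) (h x)%:E.
Proof.
move=> t0 mh; have mh' : measurable_fun P (EFin \o h) by exact/measurable_EFinP.
rewrite [LHS]integralE [RHS]integralE; congr (_ - _).
- rewrite -[RHS](ge0_integral_scale t0)//; last exact: measurable_funepos.
  apply: eq_integral => x _; rewrite !funeposE -!EFin_max -EFinM.
  by rewrite maxr_pMl ?mul0r// invr_ge0 ltW.
- rewrite -[RHS](ge0_integral_scale t0)//; last exact: measurable_funeneg.
  apply: eq_integral => x _; rewrite !funenegE -!EFinN -!EFin_max -EFinM.
  by rewrite maxr_pMl ?mul0r ?mulNr// invr_ge0 ltW.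
Qed.

End HalfLine.

(** * Mellin convolutions *)

Section ConvolutionKernel.
Context {R : realType}.
Local Notation mu := (@lebesgue_measure R).
Local Notation P := (`]0, +oo[%classic : set R).
Variables (f g : R -> R) (s : R).
Hypotheses (mf : measurable_fun P f) (mg : measurable_fun P g).
Hypotheses (f0 : forall x : R, 0 < x -> 0 <= f x) (g0 : forall x : R, 0 < x -> 0 <= g x).
Hypothesis conv_int : forall x : R, 0 < x ->
  mu.-integrable P (fun t => (f t * g (x / t) / t)%:E).

Let inP x : P x = (0 < x). Proof. by rewrite /= in_itv/= andbT. Qed.

Let mP : measurable P. Proof. exact: measurable_itv. Qed.

Lemma measurable_conv_integrand :
  measurable_fun (P `*` P) (fun z : R * R => f z.1 * g (z.2 / z.1) / z.1).
Proof.
have mPP : measurable (P `*` P) by exact: measurableX.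
have mV : measurable_fun (P `*` P) (fun z : R * R => (z.1)^-1).
  apply: (@eq_measurable_fun _ _ _ _ _ (fun z : R * R => z.1 `^ (-1))).
    move=> z; rewrite inE => -[/=]; rewrite !in_itv/= !andbT => z1 _.
    by rewrite powR_inv1// ltW.
  apply: (measurableT_comp (measurable_powR _)); exact: measurable_funTS.
have mD : measurable_fun (P `*` P) (fun z : R * R => z.2 / z.1).
  by apply: measurable_funM => //; exact: measurable_funTS.
apply: measurable_funM => //; apply: measurable_funM.
  apply: (measurable_comp mP _ mf); last exact: measurable_funTS.
  by move=> _ [z [z1 _] <-].
apply: (measurable_comp mP _ mg mD).
by move=> _ [z [z1 z2] <-]; move: z1 z2; rewrite !inP => z1 z2; exact: divr_gt0.
Qed.

Lemma measurable_mellin_conv : measurable_fun P (mellin_conv f g).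
Proof.
have mk := measurable_conv_integrand.
rewrite /mellin_conv /Rintegral.
apply: (measurableT_comp (f := fine)) => //.
apply: (@measurable_fun_fubini_tonelli_G_in _ _ _ _ _ mu P P mP mP
  (fun z => (f z.1 * g (z.2 / z.1) / z.1)%:E)); first exact/measurable_EFinP.
move=> z [/=]; rewrite !in_itv/= !andbT => z1 z2.
by rewrite lee_fin mulr_ge0 ?invr_ge0 ?(ltW z1)// mulr_ge0 ?f0 ?g0// divr_gt0.
Qed.

Lemma mellin_conv_ge0 x : 0 < x -> 0 <= mellin_conv f g x.
Proof.
move=> x0; apply: Rintegral_ge0 => t; rewrite inP => t0.
by rewrite mulr_ge0 ?invr_ge0 ?(ltW t0)// mulr_ge0 ?f0 ?g0// divr_gt0.
Qed.

Hypotheses (if_ : mu.-integrable P (fun x => (x `^ s * f x)%:E))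
           (ig : mu.-integrable P (fun x => (x `^ s * g x)%:E)).

Let M := \int[mu]_(x in P) (x `^ s * g x).

Variable u : R -> R.
Hypotheses (mu_ : measurable_fun P u) (us : forall x, 0 < x -> `|u x| <= x `^ s).

(** The integrand on the (t, x) quadrant. The weight [v] is either [u], later a real or imaginary
    part of x^(z-1), or the power x^s that dominates [u]. *)
Let K (v : R -> R) (z : R * R) := v z.2 * (f z.1 * g (z.2 / z.1) / z.1).

Let mK v : measurable_fun P v -> measurable_fun (P `*` P) (EFin \o K v).
Proof.
move=> mv; apply/measurable_EFinP; apply: measurable_funM.
  apply: (measurable_comp mP _ mv); last exact: measurable_funTS.
  by move=> _ [z [_ z2] <-].
exact: measurable_conv_integrand.
Qed.

(** Write x^s = (x/t)^s t^s and substitute y = x/t. *)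
Let powsint (t : R) : 0 < t ->
  (\int[mu]_(x in P) (K (@powR R ^~ s) (t, x))%:E = (f t * t `^ s * M)%:E)%E.
Proof.
move=> t0; rewrite /K /=.
have e x : P x -> x `^ s * (f t * g (x / t) / t) =
   (f t * t `^ s) * ((x / t) `^ s * g (x / t)) / t.
  rewrite inP => x0.
  have -> : x `^ s = (x / t) `^ s * t `^ s.
    by rewrite -powRM ?ltW ?divr_gt0// divfK// gt_eqF.
  ring.
transitivity (\int[mu]_(x in P)
    ((f t * t `^ s) * ((x / t) `^ s * g (x / t)) / t)%:E)%E.
  by apply: eq_integral => x; rewrite inE => /e ->.
rewrite (integral_scale t0 (h := fun y => (f t * t `^ s) * (y `^ s * g y))).
  under eq_integral do rewrite EFinM.
  by rewrite integralZl//= [in RHS]EFinM /M /Rintegral fineK ?integrable_fin_num.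
apply: measurable_funM => //.
by apply/measurable_EFinP; exact: measurable_int ig.
Qed.

Let k_ge0 (t x : R) : P t -> P x -> 0 <= f t * g (x / t) / t.
Proof.
rewrite !inP => t0 x0.
by rewrite mulr_ge0 ?invr_ge0 ?(ltW t0)// mulr_ge0 ?f0 ?g0// divr_gt0.
Qed.

Let mK1 v t : P t -> measurable_fun P v -> measurable_fun P (fun x => (K v (t, x))%:E).
Proof.
move=> Pt mv; have mPP : measurable (P `*` P) by exact: measurableX.
apply: (measurable_comp mPP _ (mK mv)); first by move=> _ [x Px <-].
exact/measurable_funTS/pair1_measurable.
Qed.

Let mK2 v x : P x -> measurable_fun P v -> measurable_fun P (fun t => (K v (t, x))%:E).
Proof.
move=> Px mv; have mPP : measurable (P `*` P) by exact: measurableX.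
apply: (measurable_comp mPP _ (mK mv)); first by move=> _ [t Pt <-].
exact/measurable_funTS/pair2_measurable.
Qed.

(** Replacing |u| by x^s bounds the double integral by the product of the finite Mellin integrals of
    [f] and [g] at s. *)
Let Kfin : (\int[mu]_(t in P) \int[mu]_(x in P) `|(K u (t, x))%:E| < +oo)%E.
Proof.
have e : (\int[mu]_(t in P) (f t * t `^ s * M)%:E =
          M%:E * \int[mu]_(t in P) (t `^ s * f t)%:E)%E.
  by rewrite -integralZl//; apply: eq_integral => t _; rewrite -EFinM; congr EFin; ring.
apply: (@le_lt_trans _ _ (\int[mu]_(t in P) (f t * t `^ s * M)%:E)%E); last first.
  by rewrite e -[X in (_ * X)%E]fineK ?integrable_fin_num// -EFinM ltry.
apply: ge0_le_integral => //.
- by move=> t _; apply: integral_ge0 => x _; exact: abse_ge0.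
- apply: (@measurable_fun_fubini_tonelli_F_in _ _ _ _ _ mu P P mP mP (fun z => `|(K u z)%:E|%E)).
    by apply: measurableT_comp => //; exact: mK.
  by move=> z _; exact: abse_ge0.
- apply/measurable_EFinP; apply: measurable_funM => //; apply: measurable_funM => //.
  by apply: measurable_funTS; exact: measurable_powR.
move=> t Pt; rewrite -powsint -?inP//; apply: ge0_le_integral => //.
- by apply: measurableT_comp => //; exact: mK1.
- by apply: mK1 => //; apply: measurable_funTS; exact: measurable_powR.
move=> x Px; rewrite /K/= lee_fin normrM (ger0_norm (k_ge0 Pt Px)).
by rewrite ler_wpM2r ?k_ge0 ?us -?inP.
Qed.

Let convE x : P x -> (u x * mellin_conv f g x)%:E = (\int[mu]_(t in P) (K u (t, x))%:E)%E.
Proof.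
(* The real integral is [fine] of the extended one; [conv_int] ensures that the latter is finite. *)
move=> Px; rewrite EFinM /mellin_conv /Rintegral fineK; last first.
  by apply: integrable_fin_num => //; apply: conv_int; rewrite -inP.
by rewrite -integralZl//; apply: conv_int; rewrite -inP.
Qed.

Lemma integrable_mul_mellin_conv :
  mu.-integrable P (fun x => (u x * mellin_conv f g x)%:E).
Proof.
apply/integrableP; split.
  by apply/measurable_EFinP; apply: measurable_funM => //; exact: measurable_mellin_conv.
have tonelli := @fubini_tonelli_in _ _ _ _ _ mu mu P P mP mP (fun z => `|(K u z)%:E|%E).
apply: le_lt_trans Kfin; rewrite tonelli; last 2 first.
- by apply: measurableT_comp => //; exact: mK.
- by move=> z _; exact: abse_ge0.
apply: ge0_le_integral => //.
- apply: measurableT_comp => //; apply/measurable_EFinP; apply: measurable_funM => //.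
  exact: measurable_mellin_conv.
- apply: (@measurable_fun_fubini_tonelli_G_in _ _ _ _ _ mu P P mP mP (fun z => `|(K u z)%:E|%E)).
    by apply: measurableT_comp => //; exact: mK.
  by move=> z _; exact: abse_ge0.
by move=> x Px; rewrite convE//; apply: le_abse_integral => //; exact: mK2.
Qed.

(** Fubini, then x = ty in the inner integral. The value u(ty) stays unsplit because the real and
    imaginary parts of a complex power are not multiplicative separately. *)
Lemma Rintegral_mul_mellin_conv :
  \int[mu]_(x in P) (u x * mellin_conv f g x) =
  \int[mu]_(t in P) (f t * \int[mu]_(y in P) (u (t * y) * g y)).
Proof.
congr fine; transitivity (\int[mu]_(x in P) \int[mu]_(t in P) (K u (t, x))%:E)%E.
  by apply: eq_integral => x; rewrite inE; exact: convE.
have fub := @fubini_in _ _ _ _ _ mu mu P P mP mP (EFin \o K u) (mK mu_) Kfin.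
rewrite -fub; apply: eq_integral => t; rewrite inE => Pt.
have t0 : 0 < t by rewrite -inP.
have mut : measurable_fun P (fun y => u (t * y)).
  apply: (measurable_comp mP _ mu_) => //.
  by move=> _ [y + <-]; rewrite !inP => y0; rewrite mulr_gt0.
transitivity (\int[mu]_(x in P) (f t * (u (t * (x / t)) * g (x / t)) / t)%:E)%E.
  apply: eq_integral => x _; rewrite /K/=; congr EFin.
  by rewrite (mulrC t) divfK ?gt_eqF//; ring.
rewrite (integral_scale t0 (h := fun y => f t * (u (t * y) * g y))); last first.
  by apply: measurable_funM => //; exact: measurable_funM.
have iu : mu.-integrable P (fun y => (u (t * y) * g y)%:E).
  have mPR : measurable (P : set (measurableTypeR R)) by exact: measurable_itv.
  apply: (le_integrable mPR _ _ (integrableZl mPR (t `^ s) ig)).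
    by apply/measurable_EFinP; exact: measurable_funM.
  move=> y; rewrite inP => y0 /=; rewrite lee_fin mulrA -powRM ?(ltW t0) ?(ltW y0)//.
  by rewrite !normrM ler_wpM2r// (ger0_norm (powR_ge0 _ _)) us// mulr_gt0.
under eq_integral do rewrite EFinM.
by rewrite integralZl// EFinM /Rintegral fineK ?integrable_fin_num.
Qed.

End ConvolutionKernel.

(** * Complex powers and integrals *)

Section ComplexPower.
Context {R : realType}.
Implicit Types (x y : R) (s z : R[i]).
Local Notation P := (`]0, +oo[%classic : set R).

Lemma Re_mulr_real z (r : R) : complex.Re (z * r%:C) = complex.Re z * r.
Proof. by case: z => a b /=; rewrite mulr0 subr0. Qed.

Lemma Im_mulr_real z (r : R) : complex.Im (z * r%:C) = complex.Im z * r.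
Proof. by case: z => a b /=; rewrite mulr0 add0r. Qed.

Lemma Re_cpow x s : complex.Re (cpow x s) = x `^ complex.Re s * cos (complex.Im s * ln x).
Proof. by rewrite /cpow mulrC Re_mulr_real mulrC. Qed.

Lemma Im_cpow x s : complex.Im (cpow x s) = x `^ complex.Re s * sin (complex.Im s * ln x).
Proof. by rewrite /cpow mulrC Im_mulr_real mulrC. Qed.

Lemma complex_eqP z z' : complex.Re z = complex.Re z' -> complex.Im z = complex.Im z' -> z = z'.
Proof. by case: z; case: z' => a b c d /= -> ->. Qed.

Lemma ReM z z' : complex.Re (z * z') = complex.Re z * complex.Re z' - complex.Im z * complex.Im z'.
Proof. by case: z; case: z'. Qed.

Lemma ImM z z' : complex.Im (z * z') = complex.Re z * complex.Im z' + complex.Im z * complex.Re z'.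
Proof. by case: z; case: z'. Qed.

Lemma ReD z z' : complex.Re (z + z') = complex.Re z + complex.Re z'.
Proof. by case: z; case: z'. Qed.

Lemma ImD z z' : complex.Im (z + z') = complex.Im z + complex.Im z'.
Proof. by case: z; case: z'. Qed.

Lemma ReB z z' : complex.Re (z - z') = complex.Re z - complex.Re z'.
Proof. by case: z; case: z'. Qed.

Lemma ImB z z' : complex.Im (z - z') = complex.Im z - complex.Im z'.
Proof. by case: z; case: z'. Qed.

Lemma norm_Re_cpow x s : `|complex.Re (cpow x s)| <= x `^ complex.Re s.
Proof. by rewrite Re_cpow normrM ger0_norm ?powR_ge0// ler_piMr ?powR_ge0// cos_max. Qed.

Lemma norm_Im_cpow x s : `|complex.Im (cpow x s)| <= x `^ complex.Re s.
Proof. by rewrite Im_cpow normrM ger0_norm ?powR_ge0// ler_piMr ?powR_ge0// sin_max. Qed.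

Lemma cpowM x y s : 0 < x -> 0 < y -> cpow (x * y) s = cpow x s * cpow y s.
Proof.
move=> x0 y0.
apply: complex_eqP; rewrite ?(ReM (cpow x s)) ?(ImM (cpow x s)) !(Re_cpow, Im_cpow);
  rewrite powRM ?ltW// lnM ?posrE// mulrDr ?cosD ?sinD; ring.
Qed.

Lemma cpowD x s z : 0 < x -> cpow x (s + z) = cpow x s * cpow x z.
Proof.
move=> x0; have xn0 : x != 0 by rewrite gt_eqF.
apply: complex_eqP; rewrite ?(ReM (cpow x s)) ?(ImM (cpow x s)) !(Re_cpow, Im_cpow) ReD ImD;
  rewrite powRD ?xn0 ?implybT// mulrDl ?cosD ?sinD; ring.
Qed.

Lemma cpow_real x r : cpow x r%:C = (x `^ r)%:C.
Proof. by apply: complex_eqP; rewrite ?Re_cpow ?Im_cpow /= mul0r ?cos0 ?sin0 ?mulr1 ?mulr0. Qed.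

Lemma measurable_Re_cpow s : measurable_fun P (fun x => complex.Re (cpow x s)).
Proof.
rewrite (funext (Re_cpow ^~ s)).
apply: measurable_funM; first by apply: measurable_funTS; exact: measurable_powR.
apply: (measurableT_comp (f := cos)); first by apply: continuous_measurable_fun; exact: continuous_cos.
apply: measurable_funM => //; apply: measurable_funTS; exact: measurable_ln.
Qed.

Lemma measurable_Im_cpow s : measurable_fun P (fun x => complex.Im (cpow x s)).
Proof.
rewrite (funext (Im_cpow ^~ s)).
apply: measurable_funM; first by apply: measurable_funTS; exact: measurable_powR.
apply: (measurableT_comp (f := sin)); first by apply: continuous_measurable_fun; exact: continuous_sin.
apply: measurable_funM => //; apply: measurable_funTS; exact: measurable_ln.
Qed.

End ComplexPower.

Section ComplexIntegral.
Context {R : realType}.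
Local Notation mu := (@lebesgue_measure R).
Local Notation P := (`]0, +oo[%classic : set (measurableTypeR R)).
Implicit Types (F G : R -> R[i]) (z c : R[i]).

Let mP : measurable P. Proof. exact: measurable_itv. Qed.

Lemma half_lineE (x : R) : P x = (0 < x). Proof. by rewrite /= in_itv/= andbT. Qed.

Lemma le_integrable_half (f g : R -> R) : measurable_fun P f ->
  (forall x : R, 0 < x -> `|f x| <= g x) ->
  mu.-integrable P (EFin \o g) -> mu.-integrable P (EFin \o f).
Proof.
move=> mf fg; apply: le_integrable => //; first exact/measurable_EFinP.
by move=> x; rewrite half_lineE => x0 /=; rewrite lee_fin (le_trans (fg _ x0))// ler_norm.
Qed.

Lemma Re_cintegral F : complex.Re (cintegral F) = \int[mu]_(x in P) complex.Re (F x).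
Proof. by []. Qed.

Lemma Im_cintegral F : complex.Im (cintegral F) = \int[mu]_(x in P) complex.Im (F x).
Proof. by []. Qed.

Lemma eq_cintegral F G : (forall x, 0 < x -> F x = G x) -> cintegral F = cintegral G.
Proof.
by move=> FG; congr (_ +i* _); apply: eq_Rintegral => x; rewrite inE half_lineE => /FG ->.
Qed.

Lemma eq_cintegrable F G : (forall x, 0 < x -> F x = G x) -> cintegrable F -> cintegrable G.
Proof.
move=> FG [iF1 iF2]; split.
  by apply: eq_integrable iF1 => // x; rewrite inE half_lineE => /FG /= ->.
by apply: eq_integrable iF2 => // x; rewrite inE half_lineE => /FG /= ->.
Qed.

Lemma cintegrableD F G : cintegrable F -> cintegrable G -> cintegrable (fun x => F x + G x).
Proof.
move=> [F1 F2] [G1 G2]; split.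
  apply: eq_integrable (integrableD mP F1 G1) => // x _ /=.
  by rewrite ReD EFinD.
apply: eq_integrable (integrableD mP F2 G2) => // x _ /=.
by rewrite ImD EFinD.
Qed.

Lemma cintegralD F G : cintegrable F -> cintegrable G ->
  cintegral (fun x => F x + G x) = cintegral F + cintegral G.
Proof.
move=> [F1 F2] [G1 G2]; apply: complex_eqP; rewrite ?ReD ?ImD /= -RintegralD//;
  by apply: eq_Rintegral => x _; rewrite ?ReD ?ImD.
Qed.

Lemma cintegrableZ c F : cintegrable F -> cintegrable (fun x => c * F x).
Proof.
move=> [F1 F2]; split.
  apply: eq_integrable (integrableB mP (integrableZl mP (complex.Re c) F1)
    (integrableZl mP (complex.Im c) F2)) => // x _ /=.
  by rewrite ReM EFinB !EFinM.
apply: eq_integrable (integrableD mP (integrableZl mP (complex.Re c) F2)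
    (integrableZl mP (complex.Im c) F1)) => // x _ /=.
by rewrite ImM EFinD !EFinM.
Qed.

Lemma cintegralZ c F : cintegrable F -> cintegral (fun x => c * F x) = c * cintegral F.
Proof.
move=> [F1 F2]; have Z (f : R -> R) r : mu.-integrable P (EFin \o f) ->
    mu.-integrable P (EFin \o (fun x => r * f x)).
  by move=> i; apply: eq_integrable (integrableZl mP r i).
apply: complex_eqP; rewrite ?ReM ?ImM /=.
  rewrite -!RintegralZl// -RintegralB//; [|exact: Z..].
  by apply: eq_Rintegral => x _; rewrite ReM.
rewrite -!RintegralZl// -RintegralD//; [|exact: Z..].
by apply: eq_Rintegral => x _; rewrite ImM.
Qed.

Lemma cintegrable0 : cintegrable (fun=> 0 : R[i]).
Proof. by split; exact: integrable0. Qed.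

Lemma cintegral0 : cintegral (fun=> 0 : R[i]) = 0.
Proof.
have e : \int[mu]_(x in P) (0 : R) = 0 by rewrite /Rintegral integral0.
by apply: complex_eqP.
Qed.

Lemma cintegral_sum (I : Type) (r : seq I) (F : I -> R -> R[i]) :
  (forall i, cintegrable (F i)) ->
  cintegrable (fun x => \sum_(i <- r) F i x) /\
  cintegral (fun x => \sum_(i <- r) F i x) = \sum_(i <- r) cintegral (F i).
Proof.
move=> iF; elim: r => [|i r [IH1 IH2]].
  rewrite big_nil; split; first by under eq_fun do rewrite big_nil; exact: cintegrable0.
  by under eq_fun do rewrite big_nil; exact: cintegral0.
rewrite big_cons -IH2; under eq_fun do rewrite big_cons.
by split; [exact: cintegrableD|exact: cintegralD].
Qed.

Lemma cintegrable_mellin (f : R -> R) z : measurable_fun P f ->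
  (forall x : R, 0 < x -> 0 <= f x) ->
  mu.-integrable P (fun x => (x `^ (complex.Re z - 1) * f x)%:E) ->
  cintegrable (mellin_integrand (fun x => (f x)%:C) z).
Proof.
move=> mf f0 fi; split.
  apply: le_integrable_half fi.
    rewrite /mellin_integrand (funext (fun x => Re_mulr_real (cpow x (z - 1)) (f x))).
    by apply: measurable_funM => //; exact: measurable_Re_cpow.
  move=> x x0; rewrite /mellin_integrand Re_mulr_real normrM (ger0_norm (f0 _ x0)).
  by rewrite ler_wpM2r ?f0// (le_trans (norm_Re_cpow _ _))// ReB.
apply: le_integrable_half fi.
  rewrite /mellin_integrand (funext (fun x => Im_mulr_real (cpow x (z - 1)) (f x))).
  by apply: measurable_funM => //; exact: measurable_Im_cpow.
move=> x x0; rewrite /mellin_integrand Im_mulr_real normrM (ger0_norm (f0 _ x0)).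
by rewrite ler_wpM2r ?f0// (le_trans (norm_Im_cpow _ _))// ReB.
Qed.

End ComplexIntegral.

(** * The Mellin transform turns convolutions into products *)

Section MellinConvolution.
Context {R : realType}.
Local Notation mu := (@lebesgue_measure R).
Local Notation P := (`]0, +oo[%classic : set (measurableTypeR R)).
Variables (f g : R -> R) (z : R[i]).
Hypotheses (mf : measurable_fun P f) (mg : measurable_fun P g).
Hypotheses (f0 : forall x : R, 0 < x -> 0 <= f x) (g0 : forall x : R, 0 < x -> 0 <= g x).
Hypothesis conv_int : forall x : R, 0 < x ->
  mu.-integrable P (fun t => (f t * g (x / t) / t)%:E).
Hypotheses (fi : mu.-integrable P (fun x => (x `^ (complex.Re z - 1) * f x)%:E))
           (gi : mu.-integrable P (fun x => (x `^ (complex.Re z - 1) * g x)%:E)).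

Lemma mellin_of_conv :
  cintegral (mellin_integrand (fun x => (mellin_conv f g x)%:C) z) =
  cintegral (mellin_integrand (fun x => (f x)%:C) z) *
  cintegral (mellin_integrand (fun x => (g x)%:C) z).
Proof.
have [f1 f2] := cintegrable_mellin mf f0 fi.
have [g1 g2] := cintegrable_mellin mg g0 gi.
set Mg := cintegral (mellin_integrand (fun x => (g x)%:C) z).
(* The complex identity from which the real and imaginary parts of the inner integral are read
   off. *)
have inner (t : R) : 0 < t ->
    cintegral (fun y => cpow (t * y) (z - 1) * (g y)%:C) = cpow t (z - 1) * Mg.
  move=> t0; rewrite -cintegralZ//; apply: eq_cintegral => y y0.
  by rewrite /mellin_integrand cpowM// mulrA.
transitivity (cintegral (fun t => Mg * mellin_integrand (fun x => (f x)%:C) z t)); last first.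
  by rewrite cintegralZ// mulrC.
apply: complex_eqP; rewrite ?Re_cintegral ?Im_cintegral.
  transitivity (\int[mu]_(x in P) (complex.Re (cpow x (z - 1)) * mellin_conv f g x)).
    by apply: eq_Rintegral => x _; rewrite /mellin_integrand Re_mulr_real.
  rewrite (Rintegral_mul_mellin_conv mf mg f0 g0 conv_int fi gi); last 2 first.
  - exact: measurable_Re_cpow.
  - by move=> x _; rewrite (le_trans (norm_Re_cpow _ _))// ReB.
  apply: eq_Rintegral => t; rewrite inE half_lineE => t0.
  rewrite mulrC; have := congr1 (@complex.Re R) (inner t t0); rewrite Re_cintegral => e.
  rewrite /mellin_integrand mulrA Re_mulr_real (mulrC Mg) -e; congr (_ * _).
  by apply: eq_Rintegral => y _; rewrite Re_mulr_real.
transitivity (\int[mu]_(x in P) (complex.Im (cpow x (z - 1)) * mellin_conv f g x)).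
  by apply: eq_Rintegral => x _; rewrite /mellin_integrand Im_mulr_real.
rewrite (Rintegral_mul_mellin_conv mf mg f0 g0 conv_int fi gi); last 2 first.
- exact: measurable_Im_cpow.
- by move=> x _; rewrite (le_trans (norm_Im_cpow _ _))// ReB.
apply: eq_Rintegral => t; rewrite inE half_lineE => t0.
rewrite mulrC; have := congr1 (@complex.Im R) (inner t t0); rewrite Im_cintegral => e.
rewrite /mellin_integrand mulrA Im_mulr_real (mulrC Mg) -e; congr (_ * _).
by apply: eq_Rintegral => y _; rewrite Im_mulr_real.
Qed.

End MellinConvolution.

(** * The fundamental theorem of calculus on the half-line *)

Section HalfLineFTC.
Context {R : realType}.
Local Notation mu := (@lebesgue_measure R).
Local Notation P := (`]0, +oo[%classic : set (measurableTypeR R)).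

Let mP : measurable P. Proof. exact: measurable_itv. Qed.

(** The offset 2 makes the left end strictly smaller than the right end already for n = 0. *)
Definition exhausting_itv (n : nat) : set (measurableTypeR R) :=
  `[n.+2%:R^-1, n.+2%:R]%classic.

Let lo_lt_hi n : (n.+2%:R^-1 < n.+2%:R :> R).
Proof. by rewrite (@lt_le_trans _ _ 1)// ?invf_lt1 ?ltr1n ?ler1n. Qed.

Let lo_gt0 n : (0 < n.+2%:R^-1 :> R).
Proof. by rewrite invr_gt0. Qed.

Lemma cvg_exhausting_hi : (n.+2%:R : R) @[n --> \oo] --> +oo.
Proof.
apply/cvgryPge => M; near=> n; rewrite (@le_trans _ _ n%:R)// ?ler_nat//.
  by near: n; exact: nbhs_infty_ger.
by rewrite -addn2 leq_addr.
Unshelve. all: by end_near. Qed.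

Lemma cvg_exhausting_lo : (n.+2%:R^-1 : R) @[n --> \oo] --> (0 : R).
Proof. by have := @cvg_harmonic R; rewrite -cvg_shiftS. Qed.

Lemma nondecreasing_exhausting_itv : nondecreasing_seq exhausting_itv.
Proof.
move=> m n mn; rewrite subsetEset => x; rewrite /exhausting_itv /= !in_itv/= => /andP[mx xm].
apply/andP; split; last by rewrite (le_trans xm)// ler_nat.
by rewrite (le_trans _ mx)// lef_pV2 ?posrE// ler_nat.
Qed.

Lemma exhausting_itv_sub n : exhausting_itv n `<=` P.
Proof.
move=> x; rewrite /exhausting_itv half_lineE /= in_itv/= => /andP[+ _].
exact: lt_le_trans (lo_gt0 n).
Qed.

Lemma near_exhausting_itv (x : R) : 0 < x -> \forall n \near \oo, exhausting_itv n x.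
Proof.
move=> x0; near=> n; rewrite /exhausting_itv /= in_itv/=; apply/andP; split.
  rewrite -[x]invrK lef_pV2 ?posrE ?invr_gt0//.
  by near: n; move/cvgryPge: cvg_exhausting_hi; exact.
by near: n; move/cvgryPge: cvg_exhausting_hi; exact.
Unshelve. all: by end_near. Qed.

Lemma bigcup_exhausting_itv : \bigcup_n exhausting_itv n = P.
Proof.
apply/seteqP; split; first by apply: bigcup_sub => n _; exact: exhausting_itv_sub.
move=> x; rewrite half_lineE => /near_exhausting_itv[n _ h].
by exists n => //; apply: h => /=.
Qed.

Variables F f : R -> R.
Hypotheses (dF : forall x : R, 0 < x -> is_derive x 1 F (f x))
           (cf : forall x : R, 0 < x -> {for x, continuous f}).

Let mf : measurable_fun P f.
Proof.
apply: open_continuous_measurable_fun; first exact: interval_open.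
by move=> x; rewrite inE half_lineE; exact: cf.
Qed.

Let FTC n : (\int[mu]_(x in exhausting_itv n) (f x)%:E =
  (F n.+2%:R - F n.+2%:R^-1)%:E)%E.
Proof.
have xpos x : x \in `[n.+2%:R^-1, n.+2%:R] -> (0 < x :> R).
  by rewrite in_itv/= => /andP[+ _]; exact: lt_le_trans (lo_gt0 n).
have cF (x : R) : 0 < x -> {for x, continuous F}.
  by move=> /dF[? _]; exact/differentiable_continuous/derivable1_diffP.
rewrite (@continuous_FTC2 _ f F)// ?EFinB//.
- apply: continuous_in_subspaceT => x; rewrite inE => /xpos.
  exact: cf.
- split.
  + by move=> x /subset_itv_oo_cc/xpos/dF[].
  + by apply: cvg_at_right_filter; apply: cF.
  + by apply: cvg_at_left_filter; apply: cF.
- by move=> x /subset_itv_oo_cc/xpos/dF df; rewrite derive1E derive_val.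
Qed.

(** By the fundamental theorem the integrals over the exhausting intervals are at most 2C; monotone
    convergence passes this bound to the half-line. *)
Lemma ge0_integrable_half_line (C : R) : (forall x : R, 0 < x -> 0 <= f x) ->
  (forall x : R, 0 < x -> `|F x| <= C) -> mu.-integrable P (EFin \o f).
Proof.
move=> f0 FC; apply/integrableP; split; first exact/measurable_EFinP.
have -> : (\int[mu]_(x in P) `|(EFin \o f) x| = \int[mu]_(x in P) (EFin \o f) x)%E.
  by apply: eq_integral => x; rewrite inE half_lineE => x0 /=; rewrite ger0_norm ?f0.
have := @ge0_nondecreasing_set_cvg_integral _ _ R exhausting_itv (EFin \o f) mu
  nondecreasing_exhausting_itv.
rewrite bigcup_exhausting_itv => cvI.
apply: (@le_lt_trans _ _ (C + C)%:E); last exact: ltry.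
apply: (@cvge_le _ _ _ _ (fun i => \int[mu]_(x in exhausting_itv i) (EFin \o f) x)%E); last first.
  apply: cvI.
  - by move=> i; exact: measurable_itv.
  - move=> i; apply: measurable_funS (measurableT_comp _ mf) => //.
    exact: exhausting_itv_sub.
  - by move=> i x /exhausting_itv_sub; rewrite half_lineE => x0; rewrite lee_fin f0.
apply: nearW => n; rewrite FTC lee_fin.
have h1 := FC n.+2%:R (ltr0Sn _ _); have h2 := FC _ (lo_gt0 n).
by rewrite (le_trans (ler_norm _))// (le_trans (ler_normB _ _))// lerD.
exact: eventually_filter.
Qed.

(** The integrals over the exhausting intervals converge by domination by |f|, and they equal
    differences of [F] whose limit is b - a. *)
Lemma Rintegral_half_line (a b : R) : mu.-integrable P (EFin \o f) ->
  F x @[x --> 0^'+] --> a -> F x @[x --> +oo] --> b ->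
  \int[mu]_(x in P) f x = b - a.
Proof.
move=> fi Fa Fb.
have := @dominated_convergence _ _ _ mu P mP
  (fun n => (EFin \o f) \_ (exhausting_itv n)) (EFin \o f) (abse \o (EFin \o f)).
case.
- move=> n; apply/measurable_restrict => //; first exact: measurable_itv.
  apply/measurable_EFinP; apply: measurable_funS mf => //; exact: subIsetl.
- exact/measurable_EFinP.
- apply: aeW => x; rewrite half_lineE => /near_exhausting_itv xn.
  apply: cvg_near_cst; apply: filterS xn => n xn.
  by rewrite patchE ifT// inE.
- exact: integrable_abse.
- apply: aeW => x n _; rewrite patchE; case: ifP => //= _.
  by rewrite normr0 lee_fin.
move=> _ _ I.
have J : (F n.+2%:R - F n.+2%:R^-1)%:E @[n --> \oo] --> (b - a)%:E.
  apply: cvg_EFin; first exact: nearW.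
  apply: cvgB.
    by move/cvg_pinftyP : Fb; apply; exact: cvg_exhausting_hi.
  by move/cvg_at_rightP : Fa; apply; split; [exact: lo_gt0|exact: cvg_exhausting_lo].
rewrite /Rintegral; apply: EFin_inj; rewrite fineK ?integrable_fin_num//.
apply: (cvg_unique _ _ J) => //; apply: cvg_trans I; apply: near_eq_cvg; apply: nearW => n /=.
rewrite -FTC [RHS]integral_mkcond [LHS]integral_mkcond; apply: eq_integral => x _.
rewrite !patchE; case: ifPn => //; case: ifPn => // xn /negP; rewrite !inE => xP.
by exfalso; apply: xP; move: xn; rewrite inE; exact: exhausting_itv_sub.
Qed.

End HalfLineFTC.

(** * The Gamma function *)

Section Gamma.
Context {R : realType}.
Local Notation mu := (@lebesgue_measure R).
Local Notation P := (`]0, +oo[%classic : set (measurableTypeR R)).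
Implicit Types (x y r s : R) (z : R[i]).

Let mP : measurable P. Proof. exact: measurable_itv. Qed.

(** For y <= 1 the power is at most 1. For y > 1 it is at most y^(n+1), with r <= n+1, and the
    exponential is at least 1 + y^(n+1)/(n+1)!, whence the constant 1 + (n+1)!. *)
Lemma powR_expR_bounded r : 0 <= r ->
  exists2 C, 0 < C & forall y, 0 < y -> y `^ r * expR (- y) <= C.
Proof.
move=> r0; pose n := Num.truncn r.
have rn : r <= n.+1%:R by exact/ltW/truncnS_gt.
exists (1 + n.+1`!%:R); first by rewrite ltr_wpDr.
move=> y y0; rewrite expRN ler_pdivrMr ?expR_gt0//.
have := expR_ge1Dxn n (ltW y0) => E.
have e1 : 1 <= expR y by rewrite -expR0 ler_expR ltW.
have f0 : 0 < n.+1`!%:R :> R by rewrite ltr0n fact_gt0.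
have [y1|y1] := leP y 1.
  have : y `^ r <= 1 by rewrite -(powRr0 y) ger_powR// y0.
  by move=> h; rewrite (le_trans h)// -[X in X <= _]mulr1 ler_pM// lerDl (ltW f0).
have : y `^ r <= y ^+ n.+1 by rewrite -powR_mulrn ?(ltW y0)// ler_powR// (ltW y1).
move=> h; rewrite (le_trans h)// -ler_pdivrMl ?ltr_wpDr//.
apply: le_trans E; rewrite -[X in X <= _]add0r lerD// mulrC ler_wpM2l ?exprn_ge0 ?(ltW y0)//.
by rewrite lef_pV2 ?posrE ?ltr_wpDr// lerDr.
Qed.

Lemma continuous_powR_pos r x : 0 < x -> {for x, continuous (@powR R ^~ r)}.
Proof.
by move=> x0; apply/differentiable_continuous/derivable1_diffP/derivable_powR; rewrite in_itv/= x0.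
Qed.

Lemma integrable_gamma_integrand s : 0 < s ->
  mu.-integrable P (fun x => (x `^ (s - 1) * expR (- x))%:E).
Proof.
move=> s0.
(* The integrand is bounded by a multiple of the derivative of the bounded
   function - 1 / (1 + x ^ s). *)
have D0 x : 0 < 1 + x `^ s by rewrite ltr_wpDr ?powR_ge0.
pose F x : R := - (1 + x `^ s)^-1.
pose f x : R := s * x `^ (s - 1) / (1 + x `^ s) ^+ 2.
have dF x : 0 < x -> is_derive x 1 F (f x).
  move=> x0; rewrite /F; apply: is_derive_eq.
    apply: is_deriveN; apply: is_deriveV; first by rewrite gt_eqF.
    by apply: is_deriveD; exact: is_derive1_powR.
  by rewrite /f /GRing.scale/= add0r mulNr opprK mulrC.
have cf x : 0 < x -> {for x, continuous f}.
  move=> x0; apply: cvgM; first by apply: cvgM; [exact: cvg_cst|exact: continuous_powR_pos].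
  apply: cvgV; first by rewrite expf_neq0// gt_eqF.
  by apply: cvgM; apply: cvgD; [exact: cvg_cst|exact: continuous_powR_pos|exact: cvg_cst|exact: continuous_powR_pos].
have f0 x : 0 < x -> 0 <= f x.
  by move=> x0; rewrite mulr_ge0 ?invr_ge0 ?sqr_ge0// mulr_ge0 ?powR_ge0// ltW.
have F1 x : 0 < x -> `|F x| <= 1.
  move=> x0; rewrite normrN ger0_norm ?invr_ge0 ?(ltW (D0 x))//.
  by rewrite invf_le1// lerDl powR_ge0.
have fi := ge0_integrable_half_line dF cf f0 F1.
have [C1 C10 h1] := powR_expR_bounded (ltW s0).
have [C2 C20 h2] := powR_expR_bounded (addr_ge0 (ltW s0) (ltW s0)).
(* With p = x^s the claim reduces to (1 + p)^2 exp(-x) <= 1 + 2 C1 + C2, where [C1] and [C2] bound p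
   exp(-x) and p^2 exp(-x); dividing by s cancels the factor s of [f]. *)
pose C := (1 + 2 * C1 + C2) / s.
apply: (@le_integrable_half _ _ (fun x => C * f x)).
- apply: measurable_funM; first by apply: measurable_funTS; exact: measurable_powR.
  by apply: measurable_funTS; apply: measurableT_comp => //; exact: measurable_expR.
- move=> x x0; rewrite ger0_norm ?mulr_ge0 ?powR_ge0 ?expR_ge0//.
  rewrite /C /f [X in _ <= X](_ : _ = x `^ (s - 1) * ((1 + 2 * C1 + C2) / (1 + x `^ s) ^+ 2)); last first.
    by field; rewrite !gt_eqF.
  rewrite ler_wpM2l ?powR_ge0// ler_pdivlMr ?exprn_gt0//.
  have e1 : expR (- x) <= 1 by rewrite expR_le1 oppr_le0 ltW.
  have := h1 _ x0; have := h2 _ x0; rewrite powRD ?(gt_eqF x0) ?implybT//.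
  by move: e1; set e := expR _; set p := x `^ s; nra.
exact: (integrableZl mP C fi).
Qed.

Lemma measurable_gamma_weight c : measurable_fun P (@gamma_weight R c).
Proof.
apply: measurable_funM; first by apply: measurable_funTS; exact: measurable_powR.
by apply: measurable_funTS; apply: measurableT_comp => //; exact: measurable_expR.
Qed.

Lemma gamma_weight_ge0 (c x : R) : 0 <= gamma_weight c x.
Proof. by rewrite mulr_ge0 ?powR_ge0 ?expR_ge0. Qed.

Lemma integrable_gamma_weight (c s : R) : 0 < s + c ->
  mu.-integrable P (fun x => (x `^ (s - 1) * gamma_weight c x)%:E).
Proof.
move=> sc; apply: eq_integrable (integrable_gamma_integrand sc) => // x.
rewrite inE half_lineE => x0; rewrite /gamma_weight mulrA -powRD ?(gt_eqF x0) ?implybT//.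
by congr (_ `^ _ * _)%:E; ring.
Qed.

Lemma mellin_gamma_weight c z :
  cintegral (mellin_integrand (fun x => (gamma_weight c x)%:C) z) = cGamma (z + c%:C).
Proof.
apply: eq_cintegral => x x0; rewrite /mellin_integrand /gamma_weight rmorphM/= mulrA.
by rewrite -cpow_real -cpowD// addrAC.
Qed.

Lemma cintegrable_gamma z : 0 < complex.Re z ->
  cintegrable (mellin_integrand (fun x => (expR (- x))%:C) z).
Proof.
move=> z0; apply: cintegrable_mellin; last exact: integrable_gamma_integrand.
- by apply: measurable_funTS; apply: measurableT_comp => //; exact: measurable_expR.
- by move=> x _; exact: expR_ge0.
Qed.

(** On [1, 2] the integrand is at least exp(-2), because s - 1 >= 0. This provides the nonvanishing
    by which the Gamma factors are cancelled. *)
Lemma Re_cGamma_gt0 s : 1 <= s -> 0 < complex.Re (cGamma s%:C).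
Proof.
move=> s1; have s0 : 0 < s by exact: lt_le_trans s1.
have e (x : R) : complex.Re (mellin_integrand (fun x => (expR (- x))%:C) s%:C x) =
    x `^ (s - 1) * expR (- x).
  by rewrite /mellin_integrand Re_mulr_real -[1]/(1%:C) -rmorphB cpow_real.
have -> : complex.Re (cGamma s%:C) = \int[mu]_(x in P) (x `^ (s - 1) * expR (- x)).
  by rewrite /cGamma Re_cintegral; apply: eq_Rintegral => x _; exact: e.
have fi := integrable_gamma_integrand s0.
pose Q : set (measurableTypeR R) := `[1, 2]%classic.
have mQ : measurable Q by exact: measurable_itv.
have sub : Q `<=` P.
  by move=> x; rewrite half_lineE /Q/= in_itv/= => /andP[x1 _]; exact: lt_le_trans x1.
apply: (@lt_le_trans _ _ (expR (- 2))); first exact: expR_gt0.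
rewrite -lee_fin /Rintegral fineK ?integrable_fin_num//.
apply: (@le_trans _ _ (\int[mu]_(x in Q) (x `^ (s - 1) * expR (- x))%:E)%E); last first.
  apply: ge0_subset_integral => //; first exact: measurable_int fi.
  by move=> x _; rewrite lee_fin mulr_ge0 ?powR_ge0 ?expR_ge0.
apply: (@le_trans _ _ (\int[mu]_(x in Q) (expR (- 2))%:E)%E).
  have -> : (\int[mu]_(x in Q) (expR (- 2))%:E)%E = ((expR (- 2))%:E * mu Q)%E.
    exact: integral_cst.
  by rewrite /Q lebesgue_measure_itv/= lte_fin ltr1n/= -EFinB -EFinM lee_fin; lra.
apply: ge0_le_integral => //.
  by apply: measurable_funS sub (measurable_int _ fi).
move=> x; rewrite /Q/= in_itv/= => /andP[x1 x2]; rewrite lee_fin.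
rewrite -[X in X <= _]mul1r ler_pM ?expR_ge0// ?ler_expR ?lerN2//.
by rewrite -[X in X <= _](powRr0 x) ler_powR// subr_ge0.
Qed.

Lemma is_derive_Re_cpow z x : 0 < x ->
  is_derive x 1 (fun y => complex.Re (cpow y z)) (complex.Re (z * cpow x (z - 1))).
Proof.
move=> x0; rewrite (funext (Re_cpow ^~ z)).
have dc : is_derive x 1 (fun y => cos (complex.Im z * ln y)) (- sin (complex.Im z * ln x) * (complex.Im z * x^-1)).
  apply: is_derive1_comp; rewrite -[_ * x^-1]/(complex.Im z *: x^-1).
  by apply: is_deriveZ; exact: is_derive1_ln.
apply: (is_derive_eq (is_deriveM (is_derive1_powR (complex.Re z) x0) dc)).
rewrite /GRing.scale/= ReM !Re_cpow !Im_cpow ReB ImB/= subr0.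
have -> : x `^ complex.Re z = x `^ (complex.Re z - 1) * x.
  by rewrite powRB ?(gt_eqF x0) ?implybT// powRr1 ?(ltW x0)// divfK ?gt_eqF.
by field; rewrite gt_eqF.
Qed.

Lemma is_derive_Im_cpow z x : 0 < x ->
  is_derive x 1 (fun y => complex.Im (cpow y z)) (complex.Im (z * cpow x (z - 1))).
Proof.
move=> x0; rewrite (funext (Im_cpow ^~ z)).
have dc : is_derive x 1 (fun y => sin (complex.Im z * ln y)) (cos (complex.Im z * ln x) * (complex.Im z * x^-1)).
  apply: is_derive1_comp; rewrite -[_ * x^-1]/(complex.Im z *: x^-1).
  by apply: is_deriveZ; exact: is_derive1_ln.
apply: (is_derive_eq (is_deriveM (is_derive1_powR (complex.Re z) x0) dc)).
rewrite /GRing.scale/= ImM !Re_cpow !Im_cpow ReB ImB/= subr0.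
have -> : x `^ complex.Re z = x `^ (complex.Re z - 1) * x.
  by rewrite powRB ?(gt_eqF x0) ?implybT// powRr1 ?(ltW x0)// divfK ?gt_eqF.
by field; rewrite gt_eqF.
Qed.

(** Supplies the vanishing boundary terms in the functional equation of Gamma: [F] is squeezed by
    x^s at 0 and by C/x at infinity. *)
Lemma gamma_boundary (F : R -> R) s : 0 < s ->
  (forall x, 0 < x -> `|F x| <= x `^ s * expR (- x)) ->
  F x @[x --> 0^'+] --> 0 /\ F x @[x --> +oo] --> 0.
Proof.
move=> s0 FE.
have e1 (x : R) : 0 < x -> expR (- x) <= 1 by move=> x0; rewrite expR_le1 oppr_le0 ltW.
split.
  apply: norm_cvg0; apply: (squeeze_cvgr (f := cst 0) (h := @powR R ^~ s)).
  - near=> x; have x0 : 0 < x by near: x; exact: nbhs_right_gt.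
    rewrite normr_ge0/= (le_trans (FE _ x0))// ler_piMr ?powR_ge0 ?e1//.
  - exact: cvg_cst.
  - exact: powR_cvg0.
(* The exponent s+1 instead of s leaves the decaying factor 1/x. *)
have [C C0 h] := powR_expR_bounded (addr_ge0 (ltW s0) ler01).
apply: norm_cvg0; apply: (squeeze_cvgr (f := cst 0) (h := fun x => C * x^-1)).
- near=> x; have x0 : 0 < x by near: x; exact: nbhs_pinfty_gt.
  rewrite normr_ge0/= (le_trans (FE _ x0))// ler_pdivlMr//.
  have := h _ x0; rewrite powRD ?(gt_eqF x0) ?implybT// powRr1 ?(ltW x0)//.
  by rewrite mulrAC.
- exact: cvg_cst.
- rewrite -[X in _ --> X](mulr0 C); apply: cvgM; first exact: cvg_cst.
  apply/gtr0_cvgV0; first exact: nbhs_pinfty_gt.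
  exact: cvg_id.
Unshelve. all: by end_near. Qed.

(** Integration by parts: [H] is the derivative of x^z exp(-x), which tends to 0 at both ends
    because Re z > 0, so its integral vanishes. The argument is run on the real and imaginary
    parts. *)
Lemma cGammaS z : 0 < complex.Re z -> cGamma (z + 1) = z * cGamma z.
Proof.
move=> z0; have z10 : 0 < complex.Re (z + 1) by rewrite ReD /= ltr_wpDr.
have g0 := cintegrable_gamma z0; have g1 := cintegrable_gamma z10.
pose H (x : R) : R[i] := z * mellin_integrand (fun x => (expR (- x))%:C) z x +
  (- 1) * mellin_integrand (fun x => (expR (- x))%:C) (z + 1) x.
have HE (x : R) : H x = (z * cpow x (z - 1)) * (expR (- x))%:C - cpow x z * (expR (- x))%:C.
  by rewrite /H /mellin_integrand mulN1r addrK mulrA.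
have [H1 H2] : cintegrable H by apply: cintegrableD; exact: cintegrableZ.
have IH : cintegral H = z * cGamma z - cGamma (z + 1).
  rewrite /H cintegralD ?cintegralZ ?mulN1r//; exact: cintegrableZ.
have cexp (x : R) : {for x, continuous (fun x => expR (- x) : R)}.
  apply: continuous_comp; first exact: (@continuousN _ R _ id _ (@cvg_id _ _)).
  exact: continuous_expR.
have dexp (x : R) : is_derive x 1 (expR \o -%R) (- expR (- x)).
  apply: (is_derive_eq (is_derive1_comp (is_derive_expR _) (is_deriveN (is_derive_id x 1)))).
  by rewrite mulrN1.
have cRe w (x : R) : 0 < x -> {for x, continuous (fun x => complex.Re (cpow x w))}.
  by move=> /(is_derive_Re_cpow w)[? _]; exact/differentiable_continuous/derivable1_diffP.
have cIm w (x : R) : 0 < x -> {for x, continuous (fun x => complex.Im (cpow x w))}.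
  by move=> /(is_derive_Im_cpow w)[? _]; exact/differentiable_continuous/derivable1_diffP.
suff [I1 I2] : complex.Re (cintegral H) = 0 /\ complex.Im (cintegral H) = 0.
  by apply/eqP; rewrite eq_sym -subr_eq0 -IH; apply/eqP; apply: complex_eqP.
split.
  pose F (x : R) := complex.Re (cpow x z) * (expR \o -%R) x.
  have FE x : 0 < x -> `|F x| <= x `^ complex.Re z * expR (- x).
    by move=> x0; rewrite normrM (ger0_norm (expR_ge0 _)) ler_wpM2r ?expR_ge0 ?norm_Re_cpow.
  have [F0 Foo] := gamma_boundary z0 FE.
  rewrite Re_cintegral (Rintegral_half_line _ _ H1 F0 Foo) ?subrr//.
    move=> x x0; apply: (is_derive_eq (is_deriveM (is_derive_Re_cpow z x0) (dexp x))).
    by rewrite HE ReB !Re_mulr_real /GRing.scale/=; ring.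
  move=> x x0; rewrite (_ : (fun x => complex.Re (H x)) = fun x : R =>
    (complex.Re z * complex.Re (cpow x (z - 1)) - complex.Im z * complex.Im (cpow x (z - 1))) * expR (- x)
     - complex.Re (cpow x z) * expR (- x)); last first.
    by apply/funext => y; rewrite HE ReB !Re_mulr_real ReM.
  apply: cvgB; apply: cvgM; [|exact: cexp|exact: cRe|exact: cexp].
  by apply: cvgB; (apply: cvgM; first exact: cvg_cst); [exact: cRe|exact: cIm].
pose F (x : R) := complex.Im (cpow x z) * (expR \o -%R) x.
have FE x : 0 < x -> `|F x| <= x `^ complex.Re z * expR (- x).
  by move=> x0; rewrite normrM (ger0_norm (expR_ge0 _)) ler_wpM2r ?expR_ge0 ?norm_Im_cpow.
have [F0 Foo] := gamma_boundary z0 FE.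
rewrite Im_cintegral (Rintegral_half_line _ _ H2 F0 Foo) ?subrr//.
  move=> x x0; apply: (is_derive_eq (is_deriveM (is_derive_Im_cpow z x0) (dexp x))).
  by rewrite HE ImB !Im_mulr_real /GRing.scale/=; ring.
move=> x x0; rewrite (_ : (fun x => complex.Im (H x)) = fun x : R =>
  (complex.Re z * complex.Im (cpow x (z - 1)) + complex.Im z * complex.Re (cpow x (z - 1))) * expR (- x)
   - complex.Im (cpow x z) * expR (- x)); last first.
  by apply/funext => y; rewrite HE ImB !Im_mulr_real ImM.
apply: cvgB; apply: cvgM; [|exact: cexp|exact: cIm|exact: cexp].
by apply: cvgD; (apply: cvgM; first exact: cvg_cst); [exact: cIm|exact: cRe].
Qed.

Lemma cGamma_poch z k : 0 < complex.Re z -> cGamma (z + k%:R) = poch z k * cGamma z.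
Proof.
move=> z0; elim: k => [|k IH]; first by rewrite /poch big_ord0 mul1r addr0.
rewrite -natr1 addrA cGammaS; last by rewrite ReD -(rmorph_nat (real_complex R)) ltr_wpDr.
by rewrite IH /poch big_ord_recr /= mulrA (mulrC (z + _)).
Qed.

End Gamma.

(** * Derivatives of Mellin convolutions *)

Section ConvolutionDerivative.
Context {R : realType}.
Local Notation mu := (@lebesgue_measure R).
Local Notation P := (`]0, +oo[%classic : set (measurableTypeR R)).
Implicit Types (x y t : R).
Variables (f : R -> R) (s : R).
Hypotheses (mf : measurable_fun P f) (f0 : forall x : R, 0 < x -> 0 <= f x).
Hypothesis fi : mu.-integrable P (fun x => (x `^ (s - 1) * f x)%:E).

Let mP : measurable P. Proof. exact: measurable_itv. Qed.

Lemma gamma_weightS c y : 0 < y -> gamma_weight (c + 1) y = y * gamma_weight c y.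
Proof.
move=> y0; rewrite /gamma_weight powRD ?(gt_eqF y0) ?implybT// powRr1 ?(ltW y0)//.
by rewrite mulrA (mulrC y).
Qed.

(** Boundedness of y^(s+c) exp(-y) at y = x/t bounds the weight by C (x/t)^(-s), hence the integrand
    by a constant multiple of t^(s-1) f(t). *)
Lemma integrable_conv_gamma c x : 0 <= s + c -> 0 < x ->
  mu.-integrable P (EFin \o (fun t => f t * gamma_weight c (x / t) / t)).
Proof.
move=> sc x0; have [C C0 hC] := powR_expR_bounded sc.
apply: (@le_integrable_half _ _ (fun t => C * x `^ (- s) * (t `^ (s - 1) * f t))).
- have mk := @measurable_conv_integrand _ f (gamma_weight c) mf (measurable_gamma_weight c).
  have mPP : measurable (P `*` P) by exact: measurableX.
  apply: (measurable_comp mPP _ mk (g := fun t => (t, x))).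
    by move=> _ [t Pt <-]; split=> //=; rewrite in_itv/= x0.
  exact/measurable_funTS/pair2_measurable.
- move=> t t0; have y0 : 0 < x / t by rewrite divr_gt0.
  rewrite ger0_norm ?mulr_ge0 ?f0 ?gamma_weight_ge0 ?powR_ge0 ?expR_ge0 ?invr_ge0 ?(ltW t0)//.
  have -> : C * x `^ (- s) * (t `^ (s - 1) * f t) = f t * (C * (x / t) `^ (- s)) / t.
    have -> : (x / t) `^ (- s) = x `^ (- s) * t `^ s.
      by rewrite powRM ?invr_ge0 ?(ltW x0) ?(ltW t0)// -powR_inv1 ?(ltW t0)// -powRrM mulN1r opprK.
    rewrite powRB ?(gt_eqF t0) ?implybT// powRr1 ?(ltW t0)//; ring.
  rewrite ler_wpM2r ?invr_ge0 ?(ltW t0)// ler_wpM2l ?f0//.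
  rewrite powRN ler_pdivlMr ?powR_gt0// /gamma_weight mulrAC -powRD ?(gt_eqF y0) ?implybT//.
  by rewrite addrC hC.
exact: (integrableZl mP (C * x `^ (- s)) fi).
Qed.

Lemma is_derive_gamma_weight c y : 0 < y ->
  is_derive y 1 (gamma_weight c) (y^-1 * (c * gamma_weight c y - gamma_weight (c + 1) y)).
Proof.
move=> y0; have de : is_derive y 1 (expR \o -%R) (- expR (- y)).
  apply: (is_derive_eq (is_derive1_comp (is_derive_expR _) (is_deriveN (is_derive_id y 1)))).
  by rewrite mulrN1.
apply: (is_derive_eq (is_deriveM (is_derive1_powR c y0) de)).
rewrite gamma_weightS// /gamma_weight /GRing.scale/= powRB ?(gt_eqF y0) ?implybT//.
by rewrite powRr1 ?(ltW y0)//; field; rewrite gt_eqF.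
Qed.

(** A bound uniform in x, for differentiation under the integral: the exponential factor is largest
    at [x1], and the power changes by a factor (x/x1)^c with 1 <= x/x1 <= 4. *)
Lemma gamma_weight_le4 c x1 x t : 0 < x1 -> 0 < t -> x1 <= x <= 4 * x1 ->
  gamma_weight c (x / t) <= 4 `^ `|c| * gamma_weight c (x1 / t).
Proof.
move=> x10 t0 /andP[x1x x4]; have x0 : 0 < x by exact: lt_le_trans x1x.
rewrite /gamma_weight mulrA; apply: ler_pM; rewrite ?powR_ge0 ?expR_ge0//; last first.
  by rewrite ler_expR lerN2 ler_pM2r ?invr_gt0.
have -> : x / t = (x / x1) * (x1 / t) by field; rewrite !gt_eqF.
rewrite powRM ?divr_ge0 ?(ltW x0) ?(ltW x10) ?(ltW t0)// ler_wpM2r ?powR_ge0//.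
have r1 : 1 <= x / x1 by rewrite ler_pdivlMr ?mul1r.
apply: (le_trans (ler_powR r1 (ler_norm c))).
by rewrite ge0_ler_powR ?nnegrE ?divr_ge0 ?(ltW x0) ?(ltW x10)// ler_pdivrMr.
Qed.

Lemma is_derive_mellin_conv_gamma c x : 0 <= s + c -> 0 < x ->
  is_derive x 1 (mellin_conv f (gamma_weight c))
    (x^-1 * (c * mellin_conv f (gamma_weight c) x - mellin_conv f (gamma_weight (c + 1)) x)).
Proof.
move=> sc x0; have sc1 : 0 <= s + (c + 1) by rewrite addrA addr_ge0.
(* The interval ]x1, 2x[ contains x and satisfies 2x = 4 x1, as [gamma_weight_le4] requires. *)
pose x1 := x / 2; have x10 : 0 < x1 by rewrite divr_gt0.
pose k y t := f t * gamma_weight c (y / t) / t.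
pose k' y t := y^-1 * (c * (f t * gamma_weight c (y / t) / t) - f t * gamma_weight (c + 1) (y / t) / t).
have dk y t : 0 < y -> 0 < t -> is_derive y 1 (k ^~ t) (k' y t).
  move=> y0 t0; have yt : 0 < y / t by rewrite divr_gt0.
  have dd : is_derive y 1 (fun y => y / t) t^-1.
    rewrite (_ : (fun y => y / t) = t^-1 \*: id); last by apply/funext => u; rewrite mulrC.
    by apply: (is_derive_eq (is_deriveZ _ (is_derive_id y 1))); rewrite /GRing.scale/= mulr1.
  have dg : is_derive y 1 (fun y => gamma_weight c (y / t))
      ((y / t)^-1 * (c * gamma_weight c (y / t) - gamma_weight (c + 1) (y / t)) * t^-1).
    apply: (@is_derive1_comp _ (gamma_weight c) (fun y => y / t) y _ _ _ dd).
    exact: is_derive_gamma_weight.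
  rewrite (_ : k ^~ t = (f t / t) \*: (fun y => gamma_weight c (y / t))); last first.
    by apply/funext => u; rewrite /k /GRing.scale/= mulrAC.
  apply: (is_derive_eq (is_deriveZ _ dg)).
  by rewrite /k' /GRing.scale/=; field; rewrite !gt_eqF.
(* This bounds [k'] with 1/y replaced by 1/x1, the weights by their bounds at [x1], and the
   difference by a sum. The outer absolute value makes [G] nonnegative at every real t, also off the
   half-line, where the sign of [f] is unknown. *)
pose G t := `|x1^-1 * (`|c| * 4 `^ `|c| * (f t * gamma_weight c (x1 / t) / t) +
   4 `^ `|c + 1| * (f t * gamma_weight (c + 1) (x1 / t) / t))|.
have intG : mu.-integrable P (EFin \o G).
  apply: integrable_norm.
  apply: (integrableZl mP x1^-1 (f := EFin \o (fun t => `|c| * 4 `^ `|c| * (f t * gamma_weight c (x1 / t) / t) +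
   4 `^ `|c + 1| * (f t * gamma_weight (c + 1) (x1 / t) / t)))).
  apply: (integrableD mP (f := EFin \o _) (g := EFin \o _)).
    exact: (integrableZl mP (`|c| * 4 `^ `|c|) (integrable_conv_gamma sc x10)).
  exact: (integrableZl mP (4 `^ `|c + 1|) (integrable_conv_gamma sc1 x10)).
have Iy y : `]x1, (2 * x)[%classic y -> 0 < y /\ x1 <= y <= 4 * x1.
  rewrite /= in_itv/= => /andP[h1 h2]; split; first exact: lt_trans h1.
  by rewrite (ltW h1)/= (le_trans (ltW h2))// /x1; lra.
have Ia : `]x1, (2 * x)[%classic x by rewrite /= in_itv/= /x1; apply/andP; split; lra.
have intk y : `]x1, (2 * x)[%classic y -> mu.-integrable P (EFin \o k y).
  by move=> /Iy[y0 _]; exact: integrable_conv_gamma.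
have derk y t : `]x1, (2 * x)[%classic y -> P t -> derivable (k ^~ t) y 1.
  by move=> /Iy[y0 _]; rewrite half_lineE => t0; have [] := dk _ _ y0 t0.
have G0 t : 0 <= G t by exact: normr_ge0.
have Gub y t : `]x1, (2 * x)[%classic y -> P t -> `|partial1of2 k y t| <= G t.
  move=> /Iy[y0 yx]; rewrite half_lineE => t0; rewrite partial1of2E.
  have [_ ->] := dk _ _ y0 t0.
  rewrite /k' /G normrM [leRHS]ger0_norm; last first.
    rewrite mulr_ge0 ?invr_ge0 ?(ltW x10)// addr_ge0//;
    by rewrite !mulr_ge0 ?f0 ?gamma_weight_ge0 ?powR_ge0 ?expR_ge0 ?invr_ge0 ?(ltW t0).
  apply: ler_pM => //.
    by rewrite ger0_norm ?invr_ge0 ?(ltW y0)// lef_pV2 ?posrE//; case/andP: yx.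
  have b w : f t * gamma_weight w (y / t) / t <= 4 `^ `|w| * (f t * gamma_weight w (x1 / t) / t).
    rewrite [leRHS](_ : _ = f t * (4 `^ `|w| * gamma_weight w (x1 / t)) / t); last by ring.
    by rewrite ler_wpM2r ?invr_ge0 ?(ltW t0)// ler_wpM2l ?f0// gamma_weight_le4.
  have b0 w : 0 <= f t * gamma_weight w (y / t) / t.
    by rewrite !mulr_ge0 ?f0 ?gamma_weight_ge0 ?powR_ge0 ?expR_ge0 ?invr_ge0 ?(ltW t0).
  apply: (le_trans (ler_normB _ _)); rewrite lerD//; last by rewrite ger0_norm ?b0.
  by rewrite normrM (ger0_norm (b0 c)) -[leRHS]mulrA ler_wpM2l.
have E := differentiation_under_integral mP Ia intk derk G0 intG Gub.
have D := derivable_under_integral mP Ia intk derk G0 intG Gub.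
have -> : mellin_conv f (gamma_weight c) = (fun y => \int[mu]_(t in P) k y t) by [].
apply: DeriveDef => //; rewrite -derive1E E.
transitivity (\int[mu]_(t in P) k' x t).
  by apply: eq_Rintegral => t; rewrite inE half_lineE => t0; rewrite partial1of2E; have [_ ->] := dk _ _ x0 t0.
have i1 := integrable_conv_gamma sc x0; have i2 := integrable_conv_gamma sc1 x0.
have i1c : mu.-integrable P (EFin \o (fun t => c * (f t * gamma_weight c (x / t) / t))).
  exact: (integrableZl mP c i1).
rewrite /k' RintegralZl//; last exact: (integrableB mP i1c i2).
by rewrite RintegralB// RintegralZl.
Qed.

Lemma euler_op_mellin_conv_gamma c x : 0 <= s + c -> 0 < x ->
  euler_op (mellin_conv f (gamma_weight c)) x =
  mellin_conv f (gamma_weight (c + 1)) x - c * mellin_conv f (gamma_weight c) x.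
Proof.
move=> sc x0; rewrite /euler_op derive1E.
have [_ ->] := is_derive_mellin_conv_gamma sc x0.
by field; rewrite gt_eqF.
Qed.

End ConvolutionDerivative.

(** * Mellin transforms of Euler forms *)

Section MellinConvolutionPowers.
Context {R : realType}.
Local Notation mu := (@lebesgue_measure R).
Local Notation P := (`]0, +oo[%classic : set (measurableTypeR R)).
Implicit Types (x y t s c : R) (f : R -> R) (z : R[i]) (S : set R).

Let mP : measurable P. Proof. exact: measurable_itv. Qed.

(** [S] is the set of admissible real parts of z. Measurability and nonnegativity are carried along
    because each further convolution asks for them. *)
Definition has_mellin S f (M : R[i] -> R[i]) : Prop :=
  [/\ measurable_fun P f, forall x, 0 < x -> 0 <= f x,
      forall s, S s -> mu.-integrable P (fun x => (x `^ (s - 1) * f x)%:E) &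
      forall z, S (complex.Re z) ->
        cintegral (mellin_integrand (fun x => (f x)%:C) z) = M z].

Lemma has_mellin_gamma_weight S c : (forall s, S s -> 0 < s + c) ->
  has_mellin S (gamma_weight c) (fun z => cGamma (z + c%:C)).
Proof.
move=> Sc; split.
- exact: measurable_gamma_weight.
- by move=> x _; exact: gamma_weight_ge0.
- by move=> s /Sc; exact: integrable_gamma_weight.
- by move=> z _; exact: mellin_gamma_weight.
Qed.

Lemma has_mellin_conv S f M c : (forall s, S s -> 0 < s + c) -> has_mellin S f M ->
  has_mellin S (mellin_conv f (gamma_weight c)) (fun z => M z * cGamma (z + c%:C)).
Proof.
move=> Sc [mf f0 fi fM].
have mg := measurable_gamma_weight c.
have g0 x : 0 < x -> 0 <= gamma_weight c x by move=> _; exact: gamma_weight_ge0.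
have ci s : S s -> forall x : R, 0 < x ->
    mu.-integrable P (fun t => (f t * gamma_weight c (x / t) / t)%:E).
  by move=> Ss x x0; exact: (integrable_conv_gamma mf f0 (fi s Ss) (ltW (Sc _ Ss)) x0).
split.
- exact: measurable_mellin_conv.
- by move=> x x0; exact: mellin_conv_ge0.
- move=> s Ss.
  have gi := integrable_gamma_weight (Sc _ Ss).
  apply: (integrable_mul_mellin_conv mf mg f0 g0 (ci s Ss) (fi _ Ss) gi).
    by apply: measurable_funTS; exact: measurable_powR.
  by move=> x _; rewrite ger0_norm ?powR_ge0.
- move=> z Sz; have gi := integrable_gamma_weight (Sc _ Sz).
  by rewrite (mellin_of_conv mf mg f0 g0 (ci _ Sz) (fi _ Sz) gi) fM// mellin_gamma_weight.
Qed.

Lemma has_mellin_foldl S f M (l : seq R) :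
  (forall s c, S s -> c \in l -> 0 < s + c) -> has_mellin S f M ->
  has_mellin S (foldl (fun f c => mellin_conv f (gamma_weight c)) f l)
    (fun z => M z * \prod_(c <- l) cGamma (z + c%:C)).
Proof.
elim: l f M => [|c l IH] f M Sl fM /=.
  rewrite (_ : (fun z => _) = M)//.
  by apply/funext => z; rewrite big_nil mulr1.
rewrite (_ : (fun z => _) = fun z => (M z * cGamma (z + c%:C)) *
    \prod_(d <- l) cGamma (z + d%:C)); last first.
  by apply/funext => z; rewrite big_cons mulrA.
apply: (IH _ (fun z => M z * cGamma (z + c%:C))).
  by move=> s c' Ss cl; apply: Sl => //; rewrite inE cl orbT.
by apply: has_mellin_conv => // s Ss; apply: Sl => //; rewrite inE eqxx.
Qed.

Lemma eq_euler_op f g x : (forall y : R, 0 < y -> f y = g y) -> 0 < x ->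
  euler_op f x = euler_op g x.
Proof.
move=> fg x0; rewrite /euler_op; congr (_ * _); rewrite !derive1E.
apply: near_eq_derive => //.
by near=> y; apply: fg; near: y; exact: lt_nbhsr.
Unshelve. all: by end_near. Qed.

(* As the Euler operator only acts on the last factor of a convolution, the
   functions [mellin_conv f (gamma_weight (c + j))] span all its iterates. *)
Lemma iter_euler_op_expansion f s c h : measurable_fun P f ->
  (forall x, 0 < x -> 0 <= f x) ->
  mu.-integrable P (fun x => (x `^ (s - 1) * f x)%:E) -> 0 <= s + c ->
  exists K : nat -> R,
    (forall x : R, 0 < x -> iter h euler_op (mellin_conv f (gamma_weight c)) x =
      \sum_(j < h.+1) K j * mellin_conv f (gamma_weight (c + j%:R)) x) /\
    (forall z, \sum_(j < h.+1) (K j)%:C * poch (z + c%:C) j = z ^+ h).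
Proof.
move=> mf f0 fi sc; elim: h => [|h [K [KE KP]]].
  exists (fun=> 1); split=> [x _|z]; rewrite big_ord1.
    by rewrite addr0 mul1r.
  by rewrite /poch big_ord0 mulr1.
pose U j := mellin_conv f (gamma_weight (c + j%:R)).
(* The j-th function is sent to the (j+1)-th minus c + j times itself, so K'_j = K_(j-1) - (c+j)
   K_j. The tests set to 0 the values of [K] outside 0, .., h, which are unspecified. *)
exists (fun j => (if j is i.+1 then K i else 0) - (if (j <= h)%N then (c + j%:R) * K j else 0)).
have scj j : 0 <= s + (c + j%:R) by rewrite addrA addr_ge0.
split=> [x x0|z]; last first.
  (* Termwise this is (z+c)_(j+1) - (c+j)(z+c)_j = z (z+c)_j. *)
  rewrite exprS -KP mulr_sumr.
  under eq_bigr do rewrite rmorphB /= mulrBl.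
  rewrite sumrB big_ord_recl /= mul0r add0r [X in _ - X]big_ord_recr/= ltnn mul0r addr0.
  rewrite -sumrB; apply: eq_bigr => j _ /=.
  rewrite -ltnS ltn_ord (_ : poch _ j.+1 = poch (z + c%:C) j * (z + c%:C + j%:R)); last exact: big_ord_recr.
  rewrite rmorphM rmorphD rmorph_nat /=.
  move: (poch _ _) => p.
  ring.
rewrite iterS (eq_euler_op KE x0).
have E : euler_op (fun y => \sum_(j < h.+1) K j * U j y) x = \sum_(j < h.+1) K j * euler_op (U j) x.
  have dU j := is_derive_mellin_conv_gamma mf f0 fi (scj j) x0.
  rewrite /euler_op derive1E (_ : (fun y => _) = \sum_(j < h.+1) (K j \*: U j)); last first.
    by apply/funext => y; rewrite fct_sumE.
  have [_ ->] := is_derive_sum (fun j : 'I_h.+1 => is_deriveZ (K j) (dU j)).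
  rewrite mulr_sumr; apply: eq_bigr => j _; rewrite derive1E.
  by have [_ ->] := dU j; rewrite /GRing.scale/= mulrCA.
rewrite E; under eq_bigr do rewrite (euler_op_mellin_conv_gamma mf f0 fi (scj _) x0) mulrBr.
under [RHS]eq_bigr do rewrite mulrBl.
rewrite !sumrB; congr (_ - _).
  rewrite [RHS]big_ord_recl /= mul0r add0r; apply: eq_bigr => j _.
  by rewrite -addrA natr1.
rewrite [RHS]big_ord_recr/= ltnn mul0r addr0; apply: eq_bigr => j _.
by rewrite -ltnS ltn_ord mulrA [K j * _]mulrC.
Qed.

End MellinConvolutionPowers.

(** * Mellin transforms of the Euler iterates of [w0] and of their polynomial combinations *)

Section EulerForms.
Context {R : realType} {q : nat}.
Local Notation mu := (@lebesgue_measure R).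
Local Notation P := (`]0, +oo[%classic : set (measurableTypeR R)).
Hypothesis hq : (1 < q)%N.
Variable a : 'rV[R]_q.

Let S : set R := [set s | forall i, 0 < s + a ord0 i].

(** Here q > 1 enters: at least one convolution is present, so a last Gamma weight can be split off
    for the Euler operator to act on. *)
Lemma w0_last : exists f M c,
  [/\ has_mellin S f M, forall s, S s -> 0 < s + c,
     w0 [seq a ord0 i | i <- enum 'I_q] = mellin_conv f (gamma_weight c) &
     forall z, M z * cGamma (z + c%:C) = \prod_(i < q) cGamma (z + (a ord0 i)%:C)].
Proof.
set l := [seq a ord0 i | i <- enum 'I_q].
have lS s c : S s -> c \in l -> 0 < s + c by move=> Ss /mapP[i _ ->]; exact: Ss.
have lq : size l = q by rewrite size_map size_enum_ord.
have lP z : \prod_(c <- l) cGamma (z + c%:C) = \prod_(i < q) cGamma (z + (a ord0 i)%:C).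
  by rewrite big_map enumT.
case: l lS lq lP => [|b l]; first by move=> _ /= q0; exfalso; move: hq; rewrite -q0.
case/lastP: l => [|l c]; first by move=> _ /= q1; exfalso; move: hq; rewrite -q1.
move=> lS _ lP.
exists (foldl (fun f c => mellin_conv f (gamma_weight c)) (gamma_weight b) l).
exists (fun z => cGamma (z + b%:C) * \prod_(c <- l) cGamma (z + c%:C)), c; split.
- apply: has_mellin_foldl.
    by move=> s d Ss dl; apply: lS => //; rewrite inE mem_rcons inE dl !orbT.
  by apply: has_mellin_gamma_weight => s Ss; apply: lS => //; rewrite inE eqxx.
- by move=> s Ss; apply: lS => //; rewrite inE mem_rcons inE eqxx orbT.
- by rewrite /w0 foldl_rcons.
- by move=> z; rewrite -lP big_cons big_rcons -mulrA.
Qed.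

Lemma mellin_euler_weight h (z : R[i]) : S (complex.Re z) ->
  cintegrable (mellin_integrand (fun x => (euler_weight a h x)%:C) z) /\
  cintegral (mellin_integrand (fun x => (euler_weight a h x)%:C) z) =
    z ^+ h * \prod_(i < q) cGamma (z + (a ord0 i)%:C).
Proof.
move=> Sz; have [f [M [c [fM Sc w0E ME]]]] := w0_last.
have [mf f0 fi _] := fM.
have [K [KE KP]] := iter_euler_op_expansion h mf f0 (fi _ Sz) (ltW (Sc _ Sz)).
have Scj j s : S s -> 0 < s + (c + j%:R).
  by move=> Ss; rewrite addrA ltr_wpDr// Sc.
pose U j := mellin_conv f (gamma_weight (c + j%:R)).
have UM j : has_mellin S (U j) (fun z => M z * cGamma (z + (c + j%:R)%:C)).
  by apply: has_mellin_conv => // s; exact: Scj.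
have iU j : cintegrable (mellin_integrand (fun x => (U j x)%:C) z).
  by have [mU U0 iU _] := UM j; apply: cintegrable_mellin => //; exact: iU.
have E (x : R) : 0 < x -> \sum_(j < h.+1) (K j)%:C * mellin_integrand (fun x => (U j x)%:C) z x =
    mellin_integrand (fun x => (euler_weight a h x)%:C) z x.
  move=> x0; rewrite /mellin_integrand /euler_weight w0E KE// rmorph_sum mulr_sumr.
  by apply: eq_bigr => j _; rewrite rmorphM/= mulrCA.
have [I1 I2] := @cintegral_sum R _ (index_enum 'I_h.+1)
  (fun j x => (K j)%:C * mellin_integrand (fun x => (U j x)%:C) z x)
  (fun j => cintegrableZ (K j)%:C (iU j)).
split; first exact: eq_cintegrable E I1.
rewrite -(eq_cintegral E) I2 -ME -KP mulr_suml; apply: eq_bigr => j _.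
rewrite cintegralZ//; have [_ _ _ ->//] := UM j.
rewrite -mulrA; congr (_ * _).
rewrite rmorphD rmorph_nat /= addrA cGamma_poch; first by ring.
by rewrite ReD /= Sc.
Qed.

(** Multiplication by x^k moves z to z + k, which turns z^h into (z+k)^h and makes the Gamma product
    release the Pochhammer factors. *)
Lemma mellin_euler_form (D : 'I_q -> {poly R[i]}) (z : R[i]) : S (complex.Re z) ->
  cintegrable (mellin_integrand (euler_form a D) z) /\
  cintegral (mellin_integrand (euler_form a D) z) =
    (\prod_(i < q) cGamma (z + (a ord0 i)%:C)) *
    \sum_(h < q) \sum_(k < size (D h)) (D h)`_k *
      (\prod_(i < q) poch (z + (a ord0 i)%:C) k * (z + k%:R) ^+ h).
Proof.
move=> Sz.
have Szk k : S (complex.Re (z + k%:R)).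
  by move=> i; rewrite ReD -(rmorph_nat (real_complex R)) /= addrAC ltr_wpDr// Sz.
pose V h k (x : R) := (D h)`_k * mellin_integrand (fun x => (euler_weight a h x)%:C) (z + k%:R) x.
have iV h k : cintegrable (V h k).
  by apply: cintegrableZ; exact: (mellin_euler_weight h (Szk k)).1.
have IV h := @cintegral_sum R _ (index_enum 'I_(size (D h))) (fun k => V h k) (iV h).
have [I1 I2] := @cintegral_sum R _ (index_enum 'I_q)
  (fun h x => \sum_(k < size (D h)) V h k x) (fun h => (IV h).1).
have E (x : R) : 0 < x -> \sum_(h < q) \sum_(k < size (D h)) V h k x =
    mellin_integrand (euler_form a D) z x.
  move=> x0; rewrite /mellin_integrand /euler_form mulr_sumr; apply: eq_bigr => h _.
  rewrite horner_coef mulr_suml mulr_sumr; apply: eq_bigr => k _.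
  have kE : (k%:R : R[i]) = (k%:R : R)%:C by rewrite rmorph_nat.
  rewrite /V /mellin_integrand.
  have -> : z + k%:R - 1 = z - 1 + (k%:R : R)%:C by rewrite addrAC kE.
  rewrite (cpowD (z - 1) _ x0) cpow_real powR_mulrn ?(ltW x0)//.
  have -> : (x ^+ k)%:C = x%:C ^+ k by exact: rmorphXn.
  by rewrite -(mulrA (D h)`_k) -(mulrA (cpow _ _)) mulrCA.
split; first exact: eq_cintegrable E I1.
rewrite -(eq_cintegral E) I2 mulr_sumr; apply: eq_bigr => h _.
rewrite (IV h).2 mulr_sumr; apply: eq_bigr => k _.
rewrite /V cintegralZ; last exact: (mellin_euler_weight h (Szk k)).1.
have G : \prod_(i < q) cGamma (z + k%:R + (a ord0 i)%:C) =
    \prod_(i < q) poch (z + (a ord0 i)%:C) k * \prod_(i < q) cGamma (z + (a ord0 i)%:C).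
  rewrite -big_split /=; apply: eq_bigr => i _; rewrite addrAC cGamma_poch//.
  by rewrite ReD /= Sz.
by rewrite (mellin_euler_weight h (Szk k)).2 G; ring.
Qed.

End EulerForms.

(** * Pure Euler components *)

Section PureEulerComponents.
Context {R : realType} {p q : nat}.
Variables (a : 'rV[R]_q) (beta : 'rV[R]_p) (eta : 'I_q -> nat) (m : 'I_p -> nat).

Local Notation toC := (map_poly (real_complex R)).

Lemma poly_eq_nat (F : numDomainType) (n0 : nat) (f g : {poly F}) :
  (forall n, (n0 <= n)%N -> f.[n%:R] = g.[n%:R]) -> f = g.
Proof.
move=> fg; apply/eqP; rewrite -subr_eq0; apply/eqP.
pose s : seq F := [seq n%:R | n <- iota n0 (size (f - g))].
apply: (@roots_geq_poly_eq0 _ _ s).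
- apply/allP => x /mapP[n]; rewrite mem_iota => /andP[n0n _] ->.
  by rewrite /root hornerD hornerN fg// subrr.
- rewrite map_inj_uniq ?iota_uniq// => i j /eqP.
  by rewrite eqr_nat => /eqP.
- by rewrite size_map size_iota.
Qed.

Lemma map_poly_poch (f : {poly R}) k : toC (poch f k) = poch (toC f) k.
Proof.
by rewrite rmorph_prod; apply: eq_bigr => j _; rewrite rmorphD rmorph_nat.
Qed.

Lemma horner_euler_basis h k (z : R[i]) : (toC (euler_basis a h k)).[z] =
  \prod_(i < q) poch (z + (a ord0 i)%:C) k * (z + k%:R) ^+ h.
Proof.
rewrite /euler_basis rmorphM rmorphXn hornerM horner_exp; congr (_ * _ ^+ _).
  rewrite /coord_block rmorph_prod horner_prod; apply: eq_bigr => i _.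
  by rewrite /= map_poly_poch horner_poch rmorphD /= map_polyX map_polyC hornerD hornerX hornerC.
by rewrite rmorphD rmorph_nat /= map_polyX hornerD hornerX -polyC_natr hornerC.
Qed.

Lemma horner_map_beta_poly (z : R[i]) : (toC (beta_poly beta m)).[z] =
  \prod_(i < p) poch ((beta ord0 i)%:C + (1 - z)) (m i).
Proof.
rewrite /beta_poly rmorph_prod horner_prod; apply: eq_bigr => i _.
rewrite /= map_poly_poch horner_poch; congr poch.
rewrite rmorphD rmorphB rmorph1 /= map_polyX map_polyC.
by rewrite !hornerD hornerN hornerX hornerC -polyC1 hornerC.
Qed.

Hypothesis hq : (1 < q)%N.
Hypothesis ha : forall i, -1 < a ord0 i.
Hypothesis heta : step_line eta.
Hypothesis hm : (\sum_(i < p) m i).+1 = (\sum_(h < q) eta h)%N.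

Lemma pure_euler_componentsP (D : 'I_q -> {poly R[i]}) :
  pure_euler_components a beta eta m D <->
  (forall h, (size (D h) <= eta h)%N) /\
  \sum_(h < q) \sum_(k < eta h) (D h)`_k *: toC (euler_basis a h k) =
    toC (beta_poly beta m).
Proof.
have E (z : R[i]) : (forall h, (size (D h) <= eta h)%N) ->
   (\sum_(h < q) \sum_(k < eta h) (D h)`_k *: toC (euler_basis a h k)).[z] =
   \sum_(h < q) \sum_(k < size (D h)) (D h)`_k *
      (\prod_(i < q) poch (z + (a ord0 i)%:C) k * (z + k%:R) ^+ h).
  move=> sD; rewrite horner_sum; apply: eq_bigr => h _; rewrite horner_sum.
  rewrite (big_ord_widen (eta h) (fun k => (D h)`_k *
      (\prod_(i < q) poch (z + (a ord0 i)%:C) k * (z + k%:R) ^+ h)) (sD h)).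
  rewrite [RHS]big_mkcond; apply: eq_bigr => k _; rewrite hornerZ horner_euler_basis.
  by case: ltnP => // hk; rewrite nth_default// mul0r.
split=> -[sD H]; split=> //; last first.
  move=> z Sz; have [I1 I2] := mellin_euler_form hq D Sz.
  by split=> //; rewrite I2 -E// H horner_map_beta_poly.
(* From n >= 2 and a_i > -1 follows n + a_i >= 1, the range of [Re_cGamma_gt0]. *)
apply: (@poly_eq_nat _ 2) => n n2; set z : R[i] := n%:R.
have zE : z = (n%:R : R)%:C by rewrite rmorph_nat.
have n2R : 2 <= n%:R :> R by rewrite ler_nat.
have za i : 1 <= n%:R + a ord0 i by have := ha i; lra.
have Sz i : 0 < complex.Re z + a ord0 i by rewrite zE /=; have := za i; lra.
have [_ I] := mellin_euler_form hq D Sz.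
rewrite E// horner_map_beta_poly; apply: (@mulfI _ (\prod_(i < q) cGamma (z + (a ord0 i)%:C))).
  apply/prodf_neq0 => i _; rewrite zE -rmorphD; apply/eqP => G0.
  by have := Re_cGamma_gt0 (za i); rewrite G0 ltxx.
by rewrite -I (H z Sz).2.
Qed.

Lemma pure_euler_components_divided_difference (c : nat -> 'I_q -> R) (D : 'I_q -> {poly R[i]}) :
  (forall k (l : 'I_q), (k < eta l)%N ->
     c k l = divided_difference (beta_poly beta m) (lattice_nodes a k l)) ->
  pure_euler_components a beta eta m D <-> forall h, D h = component_poly a eta c h.
Proof.
move=> hc; rewrite pure_euler_componentsP; split=> [[sD]|DE].
  by move/(component_identityP heta hm hc sD).
have sD h : (size (D h) <= eta h)%N by rewrite DE size_poly.
by split=> //; apply/(component_identityP heta hm hc sD).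
Qed.

End PureEulerComponents.

Theorem proposition4p11 (R : realType) (p q : nat) (hp : (1 <= p)%N) (hq : (1 < q)%N)
  (a : 'rV[R]_q) (beta : 'rV[R]_p)
  (ha : forall i, -1 < a ord0 i)
  (hbeta : forall i rho, -1 < beta ord0 i + a ord0 rho)
  (eta : 'I_q -> nat) (heta : step_line eta)
  (m : 'I_p -> nat) (hm : (\sum_(i < p) m i).+1 = (\sum_(h < q) eta h)%N) :
  (non_resonant a ->
     (forall D : 'I_q -> {poly R[i]},
        pure_euler_components a beta eta m D <->
        (forall h, D h = component_poly a eta (c_explicit beta m a) h)) /\
     (forall (k : nat) (l : 'I_q), (k < eta l)%N ->
        c_explicit beta m a k l =
        divided_difference (beta_poly beta m) (lattice_nodes a k l))) /\
  (~ non_resonant a ->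
     exists c : nat -> 'I_q -> R,
       (forall (k : nat) (l : 'I_q), (k < eta l)%N ->
          c_explicit beta m b k l @[b --> within [set b | non_resonant b] (nbhs a)]
            --> c k l) /\
       (forall (k : nat) (l : 'I_q), (k < eta l)%N ->
          c k l = divided_difference (beta_poly beta m) (lattice_nodes a k l)) /\
       (forall D : 'I_q -> {poly R[i]},
          pure_euler_components a beta eta m D <->
          (forall h, D h = component_poly a eta c h))).
Proof.
split=> ra.
  have hc k (l : 'I_q) : (k < eta l)%N -> c_explicit beta m a k l =
      divided_difference (beta_poly beta m) (lattice_nodes a k l).
    by move=> _; exact: c_explicit_divided_difference.
  by split=> // D; exact: pure_euler_components_divided_difference.
(* The limit is the confluent divided difference itself, and the description of the components only
   asks for divided differences, so it applies verbatim. *)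
exists (fun k l => divided_difference (beta_poly beta m) (lattice_nodes a k l)).
split; first by move=> k l _; exact: c_explicit_cvg.
by split=> // D; exact: pure_euler_components_divided_difference.
Qed.
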